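(* Let $X$ be a standard Borel space and let $\Gamma\subseteq X\times X$ be a Borel graph on $X$ whose chromatic number $\chi(\Gamma)$ is finite. Suppose that there is a bounded geometry weakly orthogonal decomposition of $X$ (with respect to $\Gamma$) with polygonal bound $P$ and orthogonality constant $Q$ satisfying $5\cdot P\le Q$. Then $$\chi_B(\Gamma)\le 2\cdot\chi(\Gamma)-1.$$
   Context: $\rho_\Gamma$ denotes the shortest-path-length metric on the connected components of $\Gamma$ (distance $\infty$ between points of different components, and to the empty set); distances between sets are infima. $\chi_B(\Gamma)$ is the Borel chromatic number, the least countable cardinal $\kappa$ for which there is a Borel map $c:X\to\kappa$ with $c(x)\neq c(y)$ for adjacent $x,y$. For a sequence $(X_k)_{k\ge1}$ of Borel subsets of $X$ write $X_k^\infty=\bigcup_{n\ge k}X_n$. The sequence is a weakly orthogonal decomposition of $X$ if (i) for every $k$ every connected component of $\Gamma\restriction(X\setminus X_k^\infty)$ is finite, and $\bigcap_{k\ge1}X_k^\infty=\varnothing$; and (ii) there is a constant $Q$ such that for every $k\ge1$, every connected component $R$ of $\Gamma\restriction(X\setminus X_k^\infty)$ and every $n\ge k$: $\rho_\Gamma(R,X_n^\infty)\le Q\Rightarrow\rho_\Gamma(R,X_n^\infty)=1$. It has bounded geometry if moreover (iii) there is a constant $P$ such that for every $k\ge1$ and every connected component $R$ of $\Gamma\restriction(X\setminus X_k^\infty)$, $|\{n\ge k:\rho_\Gamma(R,X_n)=1\}|\le P$. ''With polygonal bound $P$ and orthogonality constant $Q$'' means that $P$ is the smallest constant for which (iii)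 holds and $Q$ is a constant for which (ii) holds. *)

(* Defs.v *)
From HB Require Import structures.
From mathcomp Require Import all_boot all_order all_algebra.
From mathcomp Require Import all_classical all_reals all_analysis.

Set Implicit Arguments.
Unset Strict Implicit.
Unset Printing Implicit Defensive.
Import Order.TTheory GRing.Theory Num.Theory.

Local Open Scope classical_set_scope.
Local Open Scope card_scope.
Local Open Scope ring_scope.

Definition polish_metric (R : realType) (U : metricType R) : Prop :=
  (forall F : set_system U, ProperFilter F -> cauchy F ->
     exists l : U, F --> l) /\
  exists2 D : set U, countable D & dense D.

(* [measurableType] structures are pointed, so the space is nonempty. *)
Definition standard_borel (R : realType) (d : measure_display)
    (T : measurableType d) : Prop :=
  exists2 U : metricType R, polish_metric U &
  exists2 f : U -> T, bijective f &
    forall A : set T, measurable A <-> <<s @open U >> (f @^-1` A).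

(* A graph is its set of edges, as ordered pairs. *)
Definition is_graph (T : Type) (G : set (T * T)) : Prop :=
  (forall x, ~ G (x, x)) /\ (forall x y, G (x, y) -> G (y, x)).

Definition borel_graph (d : measure_display) (T : measurableType d)
    (G : set (T * T)) : Prop :=
  is_graph G /\ measurable G.

Definition proper_coloring (T : Type) (G : set (T * T)) (C : Type)
    (c : T -> C) : Prop :=
  forall x y, G (x, y) -> c x <> c y.

(* [is_chromatic_number G n] says that the chromatic number of [G] is finite,
   equal to [n]. *)
Definition is_chromatic_number (T : Type) (G : set (T * T)) (n : nat) : Prop :=
  (exists c : T -> 'I_n, proper_coloring G c) /\
  (forall m, (exists c : T -> 'I_m, proper_coloring G c) -> (n <= m)%N).

(* Countable cardinals as von Neumann ordinals: n = {0, ..., n - 1}, or omega. *)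
Definition countable_cardinal (K : set nat) : Prop :=
  (exists n, K = `I_n) \/ K = [set: nat].

(* Every set of naturals is measurable, so [measurable_fun] is Borelness of [c]
   into the discrete space [K]. *)
Definition borel_colorable (d : measure_display) (T : measurableType d)
    (G : set (T * T)) (K : set nat) : Prop :=
  exists c : T -> nat,
    [/\ measurable_fun [set: T] c, forall x, K (c x) & proper_coloring G c].

Definition is_borel_chromatic_number (d : measure_display)
    (T : measurableType d) (G : set (T * T)) (K : set nat) : Prop :=
  [/\ countable_cardinal K, borel_colorable G K &
      forall K', countable_cardinal K' -> borel_colorable G K' -> K #<= K'].

Fixpoint walk (T : Type) (G : set (T * T)) (n : nat) (x y : T) : Prop :=
  match n with
  | 0%N => x = y
  | m.+1 => exists2 z, G (x, z) & walk G m z y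
  end.

(* +oo when [x] and [y] lie in different components. *)
Definition graph_dist (R : realType) (T : Type) (G : set (T * T)) (x y : T)
    : \bar R :=
  ereal_inf [set (n%:R)%:E | n in [set n | walk G n x y]].

(* +oo when [A] or [B] is empty. *)
Definition graph_set_dist (R : realType) (T : Type) (G : set (T * T))
    (A B : set T) : \bar R :=
  ereal_inf [set graph_dist R G x y | x in A & y in B].

(* [C] is a connected component of the induced subgraph of [G] with vertex
   set [Y]; in particular it is nonempty. *)
Definition induced_component (T : Type) (G : set (T * T)) (Y C : set T)
    : Prop :=
  exists2 x, Y x & C = [set y | exists n, walk (G `&` Y `*` Y) n x y].

(* Sequences of sets are indexed from 1: the entry [X 0] is never used. *)
Definition tail_union (T : Type) (X : (set T)^nat) (k : nat) : set T :=
  \bigcup_(n >= k) X n.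

Definition orthogonality_constant (R : realType) (T : Type) (G : set (T * T))
    (X : (set T)^nat) (Q : R) : Prop :=
  forall (k : nat) (C : set T) (n : nat),
    (1 <= k)%N -> induced_component G (~` tail_union X k) C -> (k <= n)%N ->
    (graph_set_dist R G C (tail_union X n) <= Q%:E)%E ->
    graph_set_dist R G C (tail_union X n) = 1%E.

Definition weakly_orthogonal_decomposition (R : realType)
    (d : measure_display) (T : measurableType d) (G : set (T * T))
    (X : (set T)^nat) : Prop :=
  [/\ forall k, (1 <= k)%N -> measurable (X k),
      forall k C, (1 <= k)%N -> induced_component G (~` tail_union X k) C ->
        finite_set C,
      \bigcap_(k >= 1) tail_union X k = set0 &
      exists Q : R, orthogonality_constant G X Q].

Definition geometry_bounded_by (R : realType) (T : Type) (G : set (T * T))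
    (X : (set T)^nat) (P : nat) : Prop :=
  forall k C, (1 <= k)%N -> induced_component G (~` tail_union X k) C ->
    [set n | (k <= n)%N /\ graph_set_dist R G C (X n) = 1%E] #<= `I_P.

Definition bounded_geometry_decomposition (R : realType)
    (d : measure_display) (T : measurableType d) (G : set (T * T))
    (X : (set T)^nat) : Prop :=
  weakly_orthogonal_decomposition R G X /\
  exists P, geometry_bounded_by R G X P.

Definition polygonal_bound (R : realType) (T : Type) (G : set (T * T))
    (X : (set T)^nat) (P : nat) : Prop :=
  geometry_bounded_by R G X P /\
  forall P', geometry_bounded_by R G X P' -> (P <= P')%N.

(* Main.v *)
(* Write d_t for the distance to X_t^oo. For x outside X_n^oo let S_n(x) be the
   set of the t >= n such that the component of x in X \ X_n^oo is adjacent to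
   X_t; it has at most P elements, and S_n(x) restricted to [m, oo) is contained
   in S_m(x) for n <= m. Let the rank f_t(x, n) be the maximum over m >= n of
   the number of elements of S_m(x) that are at most t, and let W_n be the set of
   the x outside X_n^oo with d_t(x) >= 5 f_t(x, n) - 1 for all t >= n. The W_n
   increase to X.

   Let U be the set of the vertices outside some W_n but adjacent to it. The
   graph has finite components off U, because its edges there respect every W_n.
   It also has finite components on the 1-neighborhood V of U. Indeed, near x in
   V some W_n has its boundary at distance about 5 f_t from X_t^oo. Where two
   such boundaries meet, for levels n <= n', the windows of width 5 force
   f_t(x, n) = f_t(x, n') at the wall t of the second one, and then at all
   later walls; by orthogonality the first wall at which the maximal rank is
   attained is therefore the same for n and n'. So this wall t is constant on a
   component of V, which thus lies in a component of X \ X_t^oo.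

   Now color the finite components off U and those on V with chi colors each,
   and merge the two colorings, sharing one color. Borelness rests on the fact
   that the projection of a Borel set with finite sections is Borel, which
   follows from the separation theorem of Novikov. *)

Require Import Defs.
From mathcomp Require Import all_boot all_order all_algebra.
From mathcomp Require Import all_classical all_reals all_analysis.
From mathcomp Require Import lra zify.

Import Order.TTheory GRing.Theory Num.Theory.

Local Open Scope classical_set_scope.
Local Open Scope card_scope.
Local Open Scope ring_scope.

Set Implicit Arguments.
Unset Strict Implicit.
Unset Printing Implicit Defensive.

(** * Analytic sets *)

Section SouslinSets.
Local Open Scope nat_scope.
Context {d : measure_display} {T : measurableType d}.

(** Abstracts the closed balls of radius [1 / (k + 1)] about the points of a countable dense set.
    [base_complete] stands for the convergence of Cauchy sequences, and [base_out] expresses through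
    the base alone that each [B k a] is closed. *)
Record polish_base (B : nat -> nat -> set T) : Prop := PolishBase {
  base_measurable : forall k a, measurable (B k a);
  base_cover : forall k x, exists a, B k a x;
  base_complete : forall z : nat -> nat,
    (forall k, exists x, forall j, j <= k -> B j (z j) x) ->
    exists x, forall j, B j (z j) x;
  base_out : forall k a x, ~ B k a x -> exists k', forall a', B k' a' x ->
    forall u, B k' a' u -> ~ B k a u;
  base_sep : forall x y, x <> y -> exists k, forall a b, B k a x -> B k b y ->
    forall u, B k a u -> ~ B k b u;
  base_gen : forall A, measurable A ->
    <<s [set S | exists k a, S = B k a] >> A }.

Context {B : nat -> nat -> set T} (hB : polish_base B).
Implicit Types (C : set (nat -> nat)) (z : nat -> nat).

Definition agree n z z' := forall i, i < n -> z i = z' i.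

Lemma agreeW m n z z' : m <= n -> agree n z z' -> agree m z z'.
Proof. by move=> mn zz' i im; apply: zz'; apply: leq_trans mn. Qed.

(** Closedness in Baire space, where [agree n] means lying in a common cylinder. *)
Definition prefix_closed C :=
  forall z, (forall n, exists2 z', C z' & agree n z z') -> C z.

(** Continuity of [p] on [C]: small cylinders have small images. *)
Definition base_continuous C (p : (nat -> nat) -> T) :=
  forall z, C z -> forall k, exists n a,
    forall z', C z' -> agree n z z' -> B k a (p z').

(** Analytic subsets of the countable power of [T]; this one ambient space makes all the finite
    powers available through coordinates. *)
Definition souslin (E : set (nat -> T)) := exists C p,
  [/\ prefix_closed C, forall i, base_continuous C (fun z => p z i) &
      E = p @` C].

Definition analytic (A : set T) := exists C p,
  [/\ prefix_closed C, base_continuous C p & A = p @` C].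

Lemma souslin_analytic (E : set (nat -> T)) i :
  souslin E -> analytic [set x i | x in E].
Proof.
move=> [C [p [clC cp ->]]]; exists C, (fun z => p z i); split => //.
by rewrite image_comp.
Qed.

(* [column n z] reads [z] as the code of a sequence of sequences. *)
Definition column (n : nat) z : nat -> nat := fun k : nat => z (pickle (n, k)).

Definition row (zs : nat -> nat -> nat) : nat -> nat :=
  fun i => if unpickle i is Some nk then zs nk.1 nk.2 else 0.

Lemma column_row zs n : column n (row zs) = zs n.
Proof. by apply/funext => k; rewrite /column /row pickleK. Qed.

Lemma column_agree n m : exists N, forall z z',
  agree N z z' -> agree m (column n z) (column n z').
Proof.
exists (\max_(k < m) (pickle (n, nat_of_ord k)).+1) => z z' zz' k km.
by apply: zz'; apply: (bigop.bigmax_sup (Ordinal km)).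
Qed.

Lemma column_continuous C p n : base_continuous C p ->
  base_continuous [set z | C (column n z)] (fun z => p (column n z)).
Proof.
move=> cp z /= Cz k; have [m [a ma]] := cp _ Cz k.
have [N hN] := column_agree n m; exists N, a => z' Cz' zz'.
by apply: ma => //; apply: hN.
Qed.

Lemma base_continuousS C C' p : C' `<=` C -> base_continuous C p ->
  base_continuous C' p.
Proof.
move=> CC' cp z C'z k; have [n [a na]] := cp _ (CC' _ C'z) k.
by exists n, a => z' /CC' Cz'; apply: na.
Qed.

Lemma prefix_closed_column C n : prefix_closed C ->
  prefix_closed [set z | C (column n z)].
Proof.
move=> clC z hz; apply: clC => m; have [N hN] := column_agree n m.
by have [z' Cz' zz'] := hz N; exists (column n z') => //; apply: hN.
Qed.

Lemma prefix_closedI (I : Type) (C : I -> set (nat -> nat)) :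
  (forall i, prefix_closed (C i)) -> prefix_closed (\bigcap_i C i).
Proof.
move=> clC z hz i _; apply: clC => n.
by have [z' Cz' zz'] := hz n; exists z' => //; apply: Cz'.
Qed.

(** A limit code with [p z <> q z] would have nearby codes whose common image lies in two disjoint
    base sets. *)
Lemma prefix_closed_eq C p q : prefix_closed C -> base_continuous C p ->
  base_continuous C q -> prefix_closed [set z | C z /\ p z = q z].
Proof.
move=> clC cp cq z hz; have Cz : C z.
  by apply: clC => n; have [z' [Cz' _] zz'] := hz n; exists z'.
split=> //; apply: contrapT => /(base_sep hB)[k hk].
have [n [a na]] := cp _ Cz k; have [m [b mb]] := cq _ Cz k.
have [z' [Cz' e] zz'] := hz (maxn n m).
apply: (hk a b _ _ (p z')); [exact: na|exact: mb| |].
  by apply: na => //; apply: agreeW zz'; apply: leq_maxl.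
by rewrite e; apply: mb => //; apply: agreeW zz'; apply: leq_maxr.
Qed.

Lemma prefix_closed_preimage C p k a : prefix_closed C ->
  base_continuous C p -> prefix_closed [set z | C z /\ B k a (p z)].
Proof.
move=> clC cp z hz; have Cz : C z.
  by apply: clC => n; have [z' [Cz' _] zz'] := hz n; exists z'.
split=> //; apply: contrapT => /(base_out hB)[k' hk].
have [n [b nb]] := cp _ Cz k'; have [z' [Cz' e] zz'] := hz n.
by apply: (hk b _ (p z')) => //; apply: nb.
Qed.

(** Column [i] of a code names a sequence of balls, any finitely many of which meet; completeness
    provides the point, and [base_sep] its uniqueness. *)
Lemma souslinT : souslin setT.
Proof.
pose C i := [set z | forall k, exists x, forall j, j <= k ->
  B j (column i z j) x].
pose p z i := xget point [set x | forall j, B j (column i z j) x].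
have pP z i : C i z -> forall j, B j (column i z j) (p z i).
  move=> Cz; have [x xP] := base_complete hB Cz.
  by apply: (@xgetPex _ point [set y | forall j, B j (column i z j) y]); exists x.
exists (\bigcap_i C i), p; split.
- apply: prefix_closedI => i z hz k; have [N hN] := column_agree i k.+1.
  have [z' /(_ k)[x xP] /hN zz'] := hz N.
  by exists x => j jk; rewrite zz'//; apply: xP.
- move=> i z Cz k; have [N hN] := column_agree i k.+1.
  exists N, (column i z k) => z' Cz' /hN zz'.
  by rewrite zz'//; apply: pP; apply: Cz'.
- rewrite eqEsubset; split => // x _.
  have /choice[f fP] : forall i, exists z, forall j, B j (z j) (x i).
    move=> i; have /choice[z zP] : forall j, exists a, B j a (x i).
      by move=> j; apply: (base_cover hB).
    by exists z.
  have Cf : (\bigcap_i C i) (row f).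
    by move=> i _ k; exists (x i) => j _; rewrite column_row.
  exists (row f) => //; apply/funext => i; apply: contrapT => /(base_sep hB).
  move=> [k hk]; have pk := pP _ _ (Cf i I) k; rewrite column_row in pk.
  exact: (hk (f i k) (f i k) _ _ (x i)).
Qed.

Lemma souslin0 : souslin set0.
Proof.
exists set0, (fun _ _ => point); split => [z /(_ 0)[]//|i z []|].
by rewrite image_set0.
Qed.

(** A code lists codes for all the [E n] in its columns and is kept if these have the same image,
    which is a closed condition. *)
Lemma souslin_bigcap (E : nat -> set (nat -> T)) :
  (forall n, souslin (E n)) -> souslin (\bigcap_n E n).
Proof.
move=> /choice[C /choice[p hp]].
pose D := \bigcap_n [set z | C n (column n z)].
pose D' := \bigcap_(ni in [set: nat * nat]) [set z | D z /\
  p ni.1 (column ni.1 z) ni.2 = p 0 (column 0 z) ni.2].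
have clD : prefix_closed D.
  by apply: prefix_closedI => n; apply: prefix_closed_column; have [] := hp n.
have cD n i : base_continuous D (fun z => p n (column n z) i).
  apply: (@base_continuousS [set z | C n (column n z)]) => [z|]; first exact.
  by apply: (@column_continuous _ (fun z => p n z i)); have [] := hp n.
exists D', (fun z => p 0 (column 0 z)); split.
- by apply: prefix_closedI => -[n i]; apply: prefix_closed_eq.
- by move=> i; apply: base_continuousS (cD 0 i) => z /(_ (0, 0) I)[].
- rewrite eqEsubset; split => x.
    move=> Ex; have /choice[zs zsP] : forall n, exists z, C n z /\ p n z = x.
      move=> n; have [_ _ En] := hp n.
      by have := Ex n I; rewrite En => -[z]; exists z.
    exists (row zs); last by rewrite column_row; have [] := zsP 0.
    move=> [n i] _ /=; rewrite !column_row; split.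
      by move=> m _ /=; rewrite column_row; have [] := zsP m.
    by have [_ ->] := zsP n; have [_ ->] := zsP 0.
  move=> [z D'z <-] n _; have [_ _ ->] := hp n.
  exists (column n z); first by have [/(_ n I)] := D'z (0, 0) I.
  by apply/funext => i; have [] := D'z (n, i) I.
Qed.

(** The first entry of a code selects the index [n]. *)
Lemma souslin_bigcup (E : nat -> set (nat -> T)) :
  (forall n, souslin (E n)) -> souslin (\bigcup_n E n).
Proof.
move=> /choice[C /choice[p hp]]; pose tl z : nat -> nat := fun k => z k.+1.
have tl_agree n z z' : agree n.+1 z z' -> agree n (tl z) (tl z').
  by move=> zz' i ni; apply: zz'.
exists [set z | C (z 0) (tl z)], (fun z => p (z 0) (tl z)); split.
- move=> z hz /=; have [cl _ _] := hp (z 0); apply: cl => n.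
  have [z' /= Cz' zz'] := hz n.+1; exists (tl z'); last exact: tl_agree.
  by rewrite zz'.
- move=> i z /= Cz k; have [_ /(_ i _ Cz k)[n [a na]] _] := hp (z 0).
  exists n.+1, a => z' /= Cz' zz'; rewrite -(zz' 0)//.
  by apply: na; [rewrite zz'|apply: tl_agree].
- rewrite eqEsubset; split => x.
    move=> [n _]; have [_ _ ->] := hp n => -[z Cz <-].
    by exists (fun k => if k is j.+1 then z j else n).
  by move=> [z Cz <-]; exists (z 0) => //; have [_ _ ->] := hp (z 0); exists (tl z).
Qed.

Lemma souslinI E F : souslin E -> souslin F -> souslin (E `&` F).
Proof.
move=> sE sF; rewrite -bigcap2E; apply: souslin_bigcap => -[|[|n]]//=.
exact: souslinT.
Qed.

Lemma souslin_base i k a : souslin [set x | B k a (x i)].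
Proof.
have [C [p [clC cp Ep]]] := souslinT.
exists [set z | C z /\ B k a (p z i)], p; split.
- exact: (@prefix_closed_preimage _ (fun z => p z i)).
- by move=> j; apply: base_continuousS (cp j) => z [].
- rewrite eqEsubset; split => [x xB|_ [z [Cz zB] <-]//].
  by have : setT x by []; rewrite Ep => -[z Cz zx]; exists z => //=; rewrite zx.
Qed.

(** The complement of a closed ball is the union of the countably many base sets disjoint from
    it. *)
Lemma souslin_baseC i k a : souslin [set x | ~ B k a (x i)].
Proof.
pose S (n : nat) : set (nat -> T) := if unpickle n is Some (k', a') then
  (if `[< forall u, B k' a' u -> ~ B k a u >] then [set x | B k' a' (x i)]
   else set0) else set0.
rewrite (_ : mkset _ = \bigcup_n S n); last first.
  rewrite eqEsubset; split => [x /= /(base_out hB)[k' hk']|x [n _]].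
    have [a' xa'] := base_cover hB k' (x i).
    exists (pickle (k', a')) => //; rewrite /S pickleK.
    by case: asboolP => // /(_ (hk' _ xa')).
  rewrite /S; case: unpickle => // -[k' a']; case: asboolP => //= h.
  exact: h.
apply: souslin_bigcup => n; rewrite /S; case: unpickle => [[k' a']|].
  by case: asboolP => _; [apply: souslin_base|apply: souslin0].
exact: souslin0.
Qed.

Definition bisouslin (E : set (nat -> T)) := souslin E /\ souslin (~` E).

Lemma bisouslin_sigma_algebra (U : Type) (f : (nat -> T) -> U) :
  sigma_algebra setT [set A | bisouslin (f @^-1` A)].
Proof.
split => /=.
- by rewrite /bisouslin preimage_set0 setC0; split; [apply: souslin0|apply: souslinT].
- by move=> A [sA sA']; rewrite setTD /bisouslin preimage_setC setCK.
- move=> A sA; split; first by rewrite preimage_bigcup; apply: souslin_bigcup => n; have [] := sA n.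
  by rewrite preimage_bigcup setC_bigcup; apply: souslin_bigcap => n; have [] := sA n.
Qed.

Lemma souslin_measurable i (A : set T) : measurable A ->
  bisouslin [set x | A (x i)].
Proof.
move=> /(base_gen hB).
apply: (smallest_sub (@bisouslin_sigma_algebra _ (fun x => x i))).
by move=> _ [k [a ->]]; split; [apply: souslin_base|apply: souslin_baseC].
Qed.

Lemma souslin_measurable2 i j (H : set (T * T)) : measurable H ->
  bisouslin [set x | H (x i, x j)].
Proof.
rewrite measurable_prod_measurableType.
apply: (smallest_sub (@bisouslin_sigma_algebra _ (fun x => (x i, x j)))).
move=> _ [A1 mA1 [A2 mA2 <-]] /=.
have [s1 s1'] := souslin_measurable i mA1.
have [s2 s2'] := souslin_measurable j mA2.
split; first exact: souslinI.
rewrite (_ : ~` _ = [set x | ~ A1 (x i)] `|` [set x | ~ A2 (x j)]).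
  by rewrite -bigcup2E; apply: souslin_bigcup => -[|[|n]]//=; apply: souslin0.
exact: (setCI [set x | A1 (x i)] [set x | A2 (x j)]).
Qed.

End SouslinSets.

Arguments analytic {d T} B A.
Arguments bisouslin {d T} B E.

(** * Projections of Borel sets *)

Section MeasurableQuantifiers.
Context {d : measure_display} {T : measurableType d}.

Lemma measurable_ex (I : countType) (P : I -> set T) :
  (forall i, measurable (P i)) -> measurable [set x | exists i, P i x].
Proof.
move=> mP; rewrite (_ : mkset _ = \bigcup_i P i).
  by apply: countable_bigcupT_measurable.
by rewrite eqEsubset; split => x [i]; [exists i|move=> _; exists i].
Qed.

Lemma measurable_all (I : countType) (P : I -> set T) :
  (forall i, measurable (P i)) -> measurable [set x | forall i, P i x].
Proof.
move=> mP; rewrite (_ : mkset _ = ~` [set x | exists i, (~` P i) x]).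
  by apply/measurableC/measurable_ex => i; apply: measurableC.
rewrite eqEsubset; split => x /= xP; first by move=> [i]; apply.
by move=> i; apply: contrapT => Pix; apply: xP; exists i.
Qed.

Lemma measurable_prop (P : Prop) : measurable [set _ : T | P].
Proof.
have [p|np] := pselect P.
  by rewrite (_ : mkset _ = setT)// eqEsubset; split.
by rewrite (_ : mkset _ = set0)// eqEsubset; split.
Qed.

Lemma measurable_imply (P : Prop) (A : set T) : (P -> measurable A) ->
  measurable [set x | P -> A x].
Proof.
move=> mA; have [p|np] := pselect P.
  rewrite (_ : mkset _ = A); first exact: mA.
  by rewrite eqEsubset; split => x /=; [apply|].
by rewrite (_ : mkset _ = setT)// eqEsubset; split => // x _ /= /np.
Qed.

Lemma measurable_and_prop (P : Prop) (A : set T) : (P -> measurable A) ->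
  measurable [set x | P /\ A x].
Proof.
move=> mA; have [p|np] := pselect P.
  rewrite (_ : mkset _ = A); first exact: mA.
  by rewrite eqEsubset; split => x /=; [case|].
by rewrite (_ : mkset _ = set0)// -subset0 => x [].
Qed.

End MeasurableQuantifiers.

Section Projections.
Local Open Scope nat_scope.
Context {d : measure_display} {T : measurableType d}.
Context {B : nat -> nat -> set T} (hB : polish_base B).
Implicit Types (A : nat -> set T) (s : nat -> nat).

Definition separable_family A := exists S,
  [/\ forall n, measurable (S n), forall n, A n `<=` S n &
      \bigcap_n S n = set0].

Lemma separable_familyS A A' : (forall n, A n `<=` A' n) ->
  separable_family A' -> separable_family A.
Proof.
by move=> AA' [S [mS A'S S0]]; exists S; split=> // n x /AA'/A'S.
Qed.

Lemma separable_family2 A n m (S S' : set T) : n <> m ->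
  measurable S -> measurable S' -> A n `<=` S -> A m `<=` S' ->
  (forall x, S x -> ~ S' x) -> separable_family A.
Proof.
move=> nm mS mS' AS AS' SS'.
exists (fun i => if i == n then S else if i == m then S' else setT); split.
- by move=> i; case: ifP => // _; case: ifP.
- by move=> i; case: eqP => [->//|_]; case: eqP => [->//|_].
- rewrite -subset0 => x hx; apply: (SS' x).
    by have := hx n I; rewrite /= eqxx.
  by have := hx m I; rewrite /= eqxx; case: eqP => // /esym.
Qed.

Lemma separable_family0 A n : A n = set0 -> separable_family A.
Proof.
move=> An; exists (fun i => if i == n then set0 else setT); split.
- by move=> i; case: ifP.
- by move=> i; case: eqP => [->|//]; rewrite An.
- by rewrite -subset0 => x /(_ n I); rewrite /= eqxx.
Qed.

(* Novikov's theorem: if the family [A] could not be separated, one could keep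
   refining it along longer and longer prefixes of codes without making it
   separable; the limit code yields points of all the [A n], two of which
   differ and are then separated by two base sets. *)
Lemma novikov_separation A : (forall n, analytic B (A n)) ->
  \bigcap_n A n = set0 -> separable_family A.
Proof.
move=> /choice[C /choice[p hp]] A0.
(* [N l s n] is the part of [A n] given by the codes that follow [s] at the positions [(n, k)]
   numbered below [l]; a single numbering interleaves the refinements of all the [A n]. *)
pose N l s n := [set p n w | w in [set w | C n w /\
  forall k : nat, pickle (n, k) < l -> w k = s (pickle (n, k))]].
pose upd s l a : nat -> nat := fun i => if i == l then a else s i.
have step l s : ~ separable_family (N l s) ->
    exists a, ~ separable_family (N l.+1 (upd s l a)).
  move=> ns; apply: contrapT => na; apply: ns.
  have /choice[S hS] : forall a, separable_family (N l.+1 (upd s l a)).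
    by move=> a; apply: contrapT => h; apply: na; exists a.
  have NS n w : C n w ->
      (forall k : nat, pickle (n, k) < l -> w k = s (pickle (n, k))) ->
      forall a, (forall k : nat, pickle (n, k) = l -> w k = a) ->
      S a n (p n w).
    move=> Cw ws a wa; have [_ + _] := hS a; apply; exists w => //; split=> // k.
    rewrite ltnS leq_eqVlt /upd => /orP[/eqP kl|kl]; first by rewrite kl eqxx wa.
    by rewrite ltn_eqF// ws.
  (* Position [l] constrains at most one index [n0]. The separating sets for the various values [a]
     combine by union at [n0] and by intersection elsewhere. *)
  have [[[n0 k0] e]|noe] := pselect (exists nk : nat * nat, pickle nk = l).
    exists (fun n => if n == n0 then \bigcup_a S a n else \bigcap_a S a n); split.
    - move=> n; case: eqP => _.
        by apply: bigcupT_measurable => a; have [] := hS a.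
      by apply: bigcapT_measurable => a; have [] := hS a.
    - move=> n _ [w [Cw ws] <-]; case: eqP => [nn0|nn0].
        exists (w k0) => //; apply: NS => // k; rewrite -e nn0.
        by move/(pcan_inj pickleK) => [->].
      move=> a _; apply: NS => // k; rewrite -e.
      by move/(pcan_inj pickleK) => [/nn0].
    - rewrite -subset0 => x hx.
      have := hx n0 I; rewrite /= eqxx => -[a _ xa].
      have [_ _ S0] := hS a; suff : (\bigcap_n S a n) x by rewrite S0.
      move=> n _; have := hx n I => /=.
      by case: eqP => [->//|_] /(_ a I).
  have [mS0 _ S00] := hS 0; exists (S 0); split=> // n _ [w [Cw ws] <-].
  by apply: NS => // k kl; case: noe; exists (n, k).
apply: contrapT => nsA.
have /choice[f fP] : forall ls, exists a, ~ separable_family (N ls.1 ls.2) ->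
    ~ separable_family (N ls.1.+1 (upd ls.2 ls.1 a)).
  move=> [l s]; have [ns|ns] := pselect (~ separable_family (N l s)).
    by have [a ha] := step _ _ ns; exists a.
  by exists 0 => /ns.
pose fix sq l : nat -> nat :=
  if l is l'.+1 then upd (sq l') l' (f (l', sq l')) else fun=> 0.
have bad_sq l : ~ separable_family (N l (sq l)).
  elim: l => [|l IH]; last exact: (fP (l, sq l)).
  move=> sep; apply: nsA; apply: separable_familyS sep => n x.
  by have [_ _ ->] := hp n => -[w Cw <-]; exists w.
pose z i := sq i.+1 i.
have sqz l i : i < l -> sq l i = z i.
  elim: l => // l IH; rewrite ltnS leq_eqVlt => /orP[/eqP ->//|il].
  by rewrite /= /upd ltn_eqF// IH.
have badz l : ~ separable_family (N l z).
  move=> sep; apply: (bad_sq l); apply: separable_familyS sep.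
  by move=> n _ [w [Cw ws] <-]; exists w => //; split=> // k kl; rewrite ws// sqz.
have Nw n m : exists l0, forall l, l0 <= l -> forall w,
    (forall k : nat, pickle (n, k) < l -> w k = z (pickle (n, k))) ->
    agree m (column n z) w.
  exists (\max_(k < m) (pickle (n, nat_of_ord k)).+1) => l ll w wz k km.
  by rewrite wz//; apply: leq_trans ll; apply: (bigop.bigmax_sup (Ordinal km)).
have Cz n : C n (column n z).
  have [cl _ _] := hp n; apply: cl => m; have [l0 hl0] := Nw n m.
  have [[x [w [Cw ws] _]]|N0] := pselect (N l0 z n !=set0).
    by exists w => //; apply: hl0 ws.
  case: (badz l0); apply: (@separable_family0 _ n).
  by rewrite -subset0 => x Nx; apply: N0; exists x.
have [Az|/existsNP[n Az]] := pselect (forall n, p n (column n z) = p 0 (column 0 z)).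
  suff : (\bigcap_n A n) (p 0 (column 0 z)) by rewrite A0.
  by move=> n _; rewrite -(Az n); have [_ _ ->] := hp n; exists (column n z).
have [k hk] := base_sep hB Az.
have [_ cn _] := hp n; have [m [a ma]] := cn _ (Cz n) k.
have [_ c0 _] := hp 0; have [m' [a' ma']] := c0 _ (Cz 0) k.
have [l hl] := Nw n m; have [l' hl'] := Nw 0 m'.
apply: (badz (maxn l l')); apply: (@separable_family2 _ n 0 (B k a) (B k a')).
- by move=> n0; apply: Az; rewrite n0.
- exact: (base_measurable hB).
- exact: (base_measurable hB).
- by move=> _ [w [Cw ws] <-]; apply: ma => //; apply: hl ws; apply: leq_maxl.
- by move=> _ [w [Cw ws] <-]; apply: ma' => //; apply: hl' ws; apply: leq_maxr.
- by apply: hk; [apply: ma|apply: ma'].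
Qed.

(** Lusin separation, as Novikov's theorem for the family [A1, A2, A2, ...]. *)
Lemma analytic_separation (A1 A2 : set T) : analytic B A1 -> analytic B A2 ->
  (forall x, A1 x -> ~ A2 x) ->
  exists S, [/\ measurable S, A1 `<=` S & forall x, A2 x -> ~ S x].
Proof.
move=> a1 a2 A12.
have [||S [mS AS S0]] := @novikov_separation (fun n => if n == 0 then A1 else A2).
- by case.
- by rewrite -subset0 => x hx; apply: (A12 x); [have := hx 0 I|have := hx 1 I].
exists (S 0); split => //; first exact: (AS 0).
move=> x A2x S0x; suff : (\bigcap_n S n) x by rewrite S0.
by case=> // n _; apply: AS.
Qed.

Lemma analytic_projection (H : set (T * T)) : measurable H ->
  analytic B [set x | exists y, H (x, y)].
Proof.
move=> mH; have [sH _] := souslin_measurable2 hB 0 1 mH.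
rewrite (_ : mkset _ = [set x 0 | x in [set x : nat -> T | H (x 0, x 1)]]).
  exact: souslin_analytic.
rewrite eqEsubset; split => [x [y Hxy]|_ [x Hx <-]]; last by exists (x 1).
by exists (fun i => if i is 0 then x else y).
Qed.

(** [H] is extended to a Borel partial function [M] with Borel domain; the domain of [H] is then cut
    out of that of [M] by a further separation. *)
Lemma measurable_functional_projection (H : set (T * T)) : measurable H ->
  (forall x y y', H (x, y) -> H (x, y') -> y = y') ->
  measurable [set x | exists y, H (x, y)].
Proof.
move=> mH fH.
have mHI (A : set T) : measurable A -> measurable (H `&` [set xy | A xy.2]).
  move=> mA; apply: measurableI => //.
  rewrite (_ : mkset _ = setT `*` A); first exact: measurableX.
  by rewrite eqEsubset; split => [[x y]//|[x y] []].
have /choice[S hS] : forall ka, exists S, [/\ measurable S,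
    forall x y, H (x, y) -> B ka.1 ka.2 y -> S x &
    forall x y, H (x, y) -> S x -> B ka.1 ka.2 y].
  move=> [k a]; have mB := base_measurable hB k a.
  have [||x [y [Hy By]] [y' [Hy' By']]|S [mS S1 S2]] := @analytic_separation
    [set x | exists y, (H `&` [set xy | B k a xy.2]) (x, y)]
    [set x | exists y, (H `&` [set xy | (~` B k a) xy.2]) (x, y)].
  - by apply: analytic_projection; apply: mHI.
  - by apply: analytic_projection; apply: mHI; apply: measurableC.
  - by apply: By'; rewrite /= (fH _ _ _ Hy' Hy).
  exists S; split => // x y Hy By; first by apply: S1; exists y.
  by apply: contrapT => nBy; apply: (S2 x) => //; exists y.
(* Taking the least index makes the cells of level [k] disjoint; over [V k a] the value of [H] lies
   in [B k a]. *)
pose V k a : set T := [set x | S (k, a) x /\ forall b : 'I_a, ~ S (k, nat_of_ord b) x].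
have mV k a : measurable (V k a).
  apply: measurableI; first by have [] := hS (k, a).
  by apply: measurable_all => b; apply: measurableC; have [] := hS (k, nat_of_ord b).
have Vuniq k a a' x : V k a x -> V k a' x -> a = a'.
  move=> [Sa Va] [Sa' Va']; have [aa'|aa'|//] := ltngtP a a'.
    by case: (Va' (Ordinal aa')).
  by case: (Va (Ordinal aa')).
have HV x y : H (x, y) -> forall k, exists2 a, V k a x & B k a y.
  move=> Hxy k; have [a0 Ba0] := base_cover hB k y.
  have exS : exists a, `[< S (k, a) x >].
    by exists a0; apply/asboolP; have [_ + _] := hS (k, a0); apply; [exact: Hxy|].
  case: (ex_minnP exS) => m /asboolP Sm mmin.
  exists m; last by have [_ _] := hS (k, m); apply; [exact: Hxy|].
  split => // b Sb; have /mmin : `[< S (k, nat_of_ord b) x >] by apply/asboolP.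
  by rewrite leqNgt ltn_ord.
pose M := [set xy | forall k, exists a, V k a xy.1 /\ B k a xy.2].
have mM : measurable M.
  apply: measurable_all => k; apply: measurable_ex => a.
  exact: (measurableX (mV k a) (base_measurable hB k a)).
have HM : H `<=` M by move=> [x y] /HV h k; have [a] := h k; exists a.
have uM x y y' : M (x, y) -> M (x, y') -> y = y'.
  move=> My My'; apply: contrapT => /(base_sep hB)[k hk].
  have [a [Va Ba]] := My k; have [a' [Va' Ba']] := My' k.
  rewrite /= in Va Va' Ba Ba'; rewrite -(Vuniq _ _ _ _ Va Va') in Ba'.
  exact: (hk a a Ba Ba' y).
(* By completeness it suffices that for each [n] the balls attached to the cells of [x] up to level
   [n] have a common point. *)
have mdomM : measurable [set x | exists y, M (x, y)].
  rewrite (_ : mkset _ = [set x | forall n, exists c : seq nat,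
      (exists u, forall j, j <= n -> B j (nth 0 c j) u) /\
      forall j : 'I_n.+1, V j (nth 0 c j) x]).
    apply: measurable_all => n; apply: measurable_ex => c.
    apply: measurableI; first exact: measurable_prop.
    by apply: measurable_all.
  rewrite eqEsubset; split => x /=.
    move=> [y /choice[z hz]] n; exists (mkseq z n.+1); split.
      by exists y => j jn; rewrite nth_mkseq//; have [] := hz j.
    by move=> j; rewrite nth_mkseq//; have [] := hz (nat_of_ord j).
  move=> hx; have /choice[z hz] : forall k, exists a, V k a x.
    by move=> k; have [c [_ /(_ ord_max)]] := hx k; exists (nth 0 c k).
  have [k|y yB] := base_complete hB (z := z).
    have [c [[u uP] cV]] := hx k; exists u => j jk.
    have cj : V j (nth 0 c j) x := cV (Ordinal (jk : j < k.+1)).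
    by rewrite (Vuniq _ _ _ _ (hz j) cj); apply: uP.
  by exists y => k; exists (z k).
have [||x [y Hxy] [y' [My' nH]]|E [mE E1 E2]] := @analytic_separation
    [set x | exists y, H (x, y)] [set x | exists y, (M `\` H) (x, y)].
- exact: analytic_projection.
- by apply: analytic_projection; apply: measurableD.
- by apply: nH; rewrite -(uM _ _ _ (HM _ Hxy) My').
rewrite (_ : mkset _ = E `&` [set x | exists y, M (x, y)]); first exact: measurableI.
rewrite eqEsubset; split => x.
  by move=> [y Hxy]; split; [apply: E1; exists y|exists y; apply: HM].
move=> [Ex [y Mxy]]; apply: contrapT => nH; apply: (E2 x) => //.
by exists y; split => // Hxy; apply: nH; exists y.
Qed.

Lemma separating_sequence : exists D : nat -> set T,
  (forall i, measurable (D i)) /\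
  forall x y, x <> y -> exists i, D i x /\ ~ D i y.
Proof.
exists (fun i => if unpickle i is Some ka then B ka.1 ka.2 else set0); split.
  by move=> i; case: unpickle => // ka; apply: (base_measurable hB).
move=> x y /(base_sep hB)[k hk]; have [a xa] := base_cover hB k x.
exists (pickle (k, a)); rewrite pickleK; split => //= ya.
exact: (hk a a xa ya x).
Qed.

Lemma finite_trace_separation (D : nat -> set T) (F : set T) :
  (forall x y, x <> y -> exists i, D i x /\ ~ D i y) -> finite_set F ->
  exists n, forall y y', F y -> F y' ->
    (forall i, i < n -> D i y <-> D i y') -> y = y'.
Proof.
move=> sepD /finite_seqP[ys ->].
have /choice[i hi] : forall yy : T * T, exists i, yy.1 <> yy.2 ->
    D i yy.1 /\ ~ D i yy.2.
  move=> [y y']; have [e|/sepD[i hi]] := pselect (y = y'); last by exists i.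
  by exists 0.
exists (\max_(y <- ys) \max_(y' <- ys) (i (y, y')).+1) => y y' yin y'in e.
apply: contrapT => yy'; have [/= d1 d2] := hi (y, y') yy'; apply/d2/e => //.
have le1 := @leq_bigmax_seq _ ys xpredT
  (fun y => \max_(y' <- ys) (i (y, y')).+1) y yin isT.
apply: leq_trans le1.
exact: (@leq_bigmax_seq _ ys xpredT (fun y' => (i (y, y')).+1) y' y'in isT).
Qed.

(* Split [H] according to the trace of its second coordinate on [D 0, ...,
   D (n-1)]: the [x] for which some trace class still contains two points of
   the section form an analytic set [Q n], and the intersection of the [Q n] is
   empty because sections are finite. *)
Lemma measurable_finite_projection (H : set (T * T)) : measurable H ->
  (forall x, finite_set [set y | H (x, y)]) ->
  measurable [set x | exists y, H (x, y)].
Proof.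
move=> mH fH; have [D [mD sepD]] := separating_sequence.
pose eqv n y y' := forall i, i < n -> D i y <-> D i y'.
pose Q n := [set x | exists y y', [/\ H (x, y), H (x, y'), y <> y' & eqv n y y']].
have aQ n : analytic B (Q n).
  rewrite (_ : Q n = [set x 0 | x in [set x : nat -> T |
      [/\ H (x 0, x 1), H (x 0, x 2), x 1 <> x 2 & eqv n (x 1) (x 2)]]]); last first.
    rewrite eqEsubset; split => [x [y [y' h]]|_ [x h <-]]; last by exists (x 1), (x 2).
    by exists (fun i => if i is 0 then x else if i is 1 then y else y').
  apply: souslin_analytic.
  have [sH1 _] := souslin_measurable2 hB 0 1 mH.
  have [sH2 _] := souslin_measurable2 hB 0 2 mH.
  (* Through the separating sequence, being distinct and having equal traces become Borel conditions
     on pairs. *)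
  pose K1 i := D i `*` ~` D i.
  have [sN _] : bisouslin B [set x | (\bigcup_i K1 i) (x 1, x 2)].
    apply: (souslin_measurable2 hB); apply: bigcupT_measurable => i.
    by apply: measurableX => //; apply: measurableC.
  pose K2 := [set xy : T * T | forall i : 'I_n,
    ((D i `*` D i) `|` (~` D i `*` ~` D i)) xy].
  have [sE _] : bisouslin B [set x | K2 (x 1, x 2)].
    apply: (souslin_measurable2 hB); apply: measurable_all => i.
    by apply: measurableU; apply: measurableX => //; apply: measurableC.
  have := souslinI hB (souslinI hB sH1 sH2) (souslinI hB sN sE).
  congr souslin; rewrite eqEsubset; split => x /=.
    move=> [[h1 h2] [[i _ [d1 d2]] k2]]; split => // [e|j jn].
      by apply: d2; rewrite /= -e.
    by have [[]|[]] := k2 (Ordinal jn).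
  move=> [h1 h2 /sepD[i hi] e]; do 2 split => //.
    by exists i.
  move=> j; have /= := e j (ltn_ord j).
  by have [dj /iffLR/(_ dj)|dj /iffRL h] := pselect (D j (x 1)); [left|right; split => // /h].
have Q0 : \bigcap_n Q n = set0.
  rewrite -subset0 => x hx.
  have [n hn] := finite_trace_separation sepD (fH x).
  have [y [y' [Hy Hy' yy' e]]] := hx n I.
  by apply: yy'; apply: hn.
have [S [mS QS S0]] := novikov_separation aQ Q0.
pose atom n (c : seq bool) := [set y | forall i : 'I_n, if nth false c i then D i y else ~ D i y].
have matom n c : measurable (atom n c).
  by apply: measurable_all => i; case: nth => //; apply: measurableC.
(* Off [S n], hence off [Q n], a section has at most one point in each trace class, so [Hn n c] is
   functional. *)
pose Hn n c := H `&` (~` S n `*` atom n c).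
rewrite (_ : mkset _ = [set x | exists n c, exists y, Hn n c (x, y)]).
  apply: measurable_ex => n; apply: measurable_ex => c.
  apply: measurable_functional_projection.
    by apply: measurableI => //; apply: measurableX => //; apply: measurableC.
  move=> x y y' [Hy [nS ay]] [Hy' [_ ay']]; apply: contrapT => yy'.
  apply: nS; apply: QS; exists y, y'; split => // i ni.
  by have := ay (Ordinal ni); have := ay' (Ordinal ni); rewrite /=; case: nth.
rewrite eqEsubset; split => x; last by move=> [n [c [y [Hxy _]]]]; exists y.
move=> [y Hxy]; have [n nS] : exists n, ~ S n x.
  apply: contrapT => h; suff : (\bigcap_n S n) x by rewrite S0.
  by move=> n _; apply: contrapT => nS; apply: h; exists n.
exists n, (mkseq (fun i => `[< D i y >]) n), y; split => //; split => // i.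
by rewrite nth_mkseq//; case: asboolP.
Qed.

End Projections.

(** * Closed balls of a Polish metric as a base *)

Section PolishBase.
Context {R : realType} {d : measure_display} {T : measurableType d}.

Lemma open_mdist_gt (U : metricType R) (q : U) (r : R) :
  open [set v | r < mdist q v].
Proof.
rewrite openE => u /= ru; apply/nbhs_ballP; exists (mdist q u - r) => /=.
  by rewrite subr_gt0.
move=> v; rewrite ballEmdist /= => uv.
by have := metric_triangle q v u; rewrite (metric_sym v u); lra.
Qed.

Lemma open_mdist_lt (U : metricType R) (q : U) (r : R) :
  open [set v | mdist q v < r].
Proof.
rewrite openE => u /= ru; apply/nbhs_ballP; exists (r - mdist q u) => /=.
  by rewrite subr_gt0.
move=> v; rewrite ballEmdist /= => uv.
by have := metric_triangle q u v; lra.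
Qed.

Lemma standard_borel_polish_base : standard_borel R T ->
  exists B : nat -> nat -> set T, polish_base B.
Proof.
move=> [U [complU [D cD dD]]] [f [g gK fK]] mT.
have /countable_injP[phi phi_inj] := cD.
(* An enumeration of the dense set, with a default value at the numbers that code no point. *)
pose q n : U := xget (g point) [set u | D u /\ phi u = n].
have qphi u : D u -> q (phi u) = u.
  move=> Du; have [Dq /phi_inj e] :
      D (q (phi u)) /\ phi (q (phi u)) = phi u.
    by apply: (@xgetPex _ _ [set v | D v /\ phi v = phi u]); exists u.
  by apply: e; rewrite inE.
pose r k : R := k.+1%:R^-1.
have r_gt0 k : 0 < r k by rewrite /r invr_gt0.
have r_small e : 0 < e -> exists k, r k < e.
  by move=> /ltr_add_invr[k]; rewrite add0r; exists k.
have r_le j k : (j <= k)%N -> r k <= r j.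
  by move=> jk; rewrite /r lef_pV2 ?posrE ?ltr0n// ler_nat.
pose B k a := [set x | mdist (q a) (g x) <= r k].
have Bcover k x : exists a, B k a x.
  have [v [/= vr Dv]] : [set v | mdist (g x) v < r k] `&` D !=set0.
    by apply: dD; [exists (g x); rewrite /= mdistxx|apply: open_mdist_lt].
  by exists (phi v); rewrite /B /= qphi// metric_sym ltW.
exists B; split => //.
- move=> k a; apply/mT.
  rewrite (_ : _ @^-1` _ = ~` [set v | r k < mdist (q a) v]).
    rewrite -setTD; apply: sigma_algebraCD; apply: sub_gen_smallest.
    exact: open_mdist_gt.
  rewrite eqEsubset; split => v; rewrite /B /= gK => h; first by rewrite ltNge h.
  by rewrite leNgt; apply/negP.
- move=> z /choice[y hy]; pose u k := g (y k).
  have uq j k : (j <= k)%N -> mdist (q (z j)) (u k) <= r j by move=> /hy.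
  have /complU[l ul] : cauchy (u @ \oo).
    apply: cauchy_exP => e e0; have [k ke] := r_small e e0.
    exists (q (z k)); exists k => // n /= kn; rewrite ballEmdist /=.
    exact: le_lt_trans (uq _ _ kn) ke.
  exists (f l) => j; rewrite /B /= gK leNgt; apply/negP => jl.
  have /ul[N _ hN] : nbhs l [set v | r j < mdist (q (z j)) v].
    by apply: open_nbhs_nbhs; split => //; apply: open_mdist_gt.
  have := hN (maxn N j) (leq_maxl _ _); rewrite /= ltNge => /negP; apply.
  exact: uq (leq_maxr _ _).
- move=> k a x /negP; rewrite -ltNge => kx.
  (* Two points of a ball of radius [r k'] are at distance at most [2 * r k'], whence the 2. For
     [base_sep] the path from [x] to [y] through both centers and [u] has four links, whence the
     4. *)
  have [|k' hk'] := r_small ((mdist (q a) (g x) - r k) / 2).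
    by rewrite divr_gt0// subr_gt0.
  exists k' => a'; rewrite /B /= => a'x u a'u au.
  have := metric_triangle (q a) (g u) (g x).
  have := metric_triangle (g u) (q a') (g x).
  by rewrite (metric_sym (g u) (q a')); lra.
- move=> x y xy; have xy0 : 0 < mdist (g x) (g y).
    by rewrite mdist_gt0; apply/eqP => /(can_inj fK).
  have [|k hk] := r_small (mdist (g x) (g y) / 4); first by rewrite divr_gt0.
  exists k => a b; rewrite /B /= => ax by_ u au bu.
  have := metric_triangle (g x) (q a) (g y).
  have := metric_triangle (q a) (g u) (g y).
  have := metric_triangle (g u) (q b) (g y).
  by rewrite (metric_sym (g u) (q b)) (metric_sym (g x) (q a)); lra.
- pose G := [set S | exists k a, S = B k a].
  move=> A /mT mA; rewrite (_ : A = g @^-1` (f @^-1` A)); last first.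
    by rewrite eqEsubset; split => x /=; rewrite fK.
  move: (_ @^-1` A) mA => V.
  apply: (@smallest_sub _ (sigma_algebra setT) _ [set V | <<s G >> (g @^-1` V)]).
    split => /=.
    + by rewrite preimage_set0; apply: sigma_algebra0.
    + by move=> W mW; rewrite setTD preimage_setC; apply: sigma_algebraC.
    + by move=> W mW; rewrite preimage_bigcup; apply: sigma_algebra_bigcup.
  move=> {}V oV /=.
  rewrite (_ : _ @^-1` _ = \bigcup_n (if unpickle n is Some (k, a) then
      if `[< B k a `<=` g @^-1` V >] then B k a else set0 else set0)).
    apply: sigma_algebra_bigcup => n; case: unpickle => [[k a]|].
      case: asboolP => _; last exact: sigma_algebra0.
      by apply: sub_gen_smallest; exists k, a.
    exact: sigma_algebra0.
  rewrite eqEsubset; split => x; last first.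
    by move=> [n _]; case: unpickle => // -[k a]; case: asboolP => // h /h.
  rewrite /= => Vx; move: (oV); rewrite openE => /(_ _ Vx)/nbhs_ballP[e /= e0 he].
  have [|k hk] := r_small (e / 2); first by rewrite divr_gt0.
  have [a ax] := Bcover k x; exists (pickle (k, a)) => //; rewrite pickleK.
  case: asboolP => // h; exfalso; apply: h => u au; apply: he.
  rewrite ballEmdist /=; have := metric_triangle (g x) (q a) (g u).
  by move: ax au; rewrite /B /= (metric_sym (g x) (q a)); lra.
Qed.

End PolishBase.

(** * Combinatorics of the decomposition *)

Section Neighborhoods.
Local Open Scope nat_scope.
Context {T : Type} (G : set (T * T)).
Implicit Types A Y : set T.

Definition nbr A := [set x | exists2 y, A y & G (x, y)].

(** The closed neighborhood of radius [l] for the graph distance, which avoids infima in the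
    combinatorial part. *)
Fixpoint vicinity A l := if l is k.+1 then vicinity A k `|` nbr (vicinity A k)
  else A.

Definition inside Y : set (T * T) := G `&` Y `*` Y.

Definition component Y x := [set y | exists n, walk (inside Y) n x y].

Definition finite_components Y := forall x, Y x -> finite_set (component Y x).

Definition reach Y A := [set x | Y x /\ exists2 y, A y & component Y x y].

Lemma vicinityW A l l' : l <= l' -> vicinity A l `<=` vicinity A l'.
Proof.
elim: l' => [|l' IH]; first by rewrite leqn0 => /eqP ->.
by rewrite leq_eqVlt => /orP[/eqP -> //|/IH h x /h]; left.
Qed.

Lemma vicinity_walk A l x : vicinity A l x ->
  exists2 n, n <= l & exists2 y, A y & walk G n x y.
Proof.
elim: l x => [|l IH] x; first by move=> Ax; exists 0 => //; exists x.
move=> [/IH[n nl h]|[y /IH[n nl [z Az yz]] xy]].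
  by exists n => //; apply: leqW.
by exists n.+1 => //; exists z => //; exists y.
Qed.

Lemma walk_invariant (Y : set T) (I : T -> Prop) n x y : I x ->
  (forall u v, inside Y (u, v) -> I u -> I v) -> walk (inside Y) n x y -> I y.
Proof.
move=> Ix hI; elim: n x Ix => [|n IH] x Ix /=; first by move<-.
by move=> [z xz]; apply: IH; apply: hI xz Ix.
Qed.

Lemma component_rcons Y x u v : component Y x u -> inside Y (u, v) ->
  component Y x v.
Proof.
move=> [m um] uv; exists m.+1; elim: m x um => [|m IH] z /=.
  by move=> ->; exists v.
by move=> [w zw /IH wv]; exists w.
Qed.

Lemma component_subset (Y Y' : set T) x :
  (forall u v, inside Y (u, v) -> component Y x u -> Y' u -> Y' v) -> Y' x ->
  component Y x `<=` component Y' x.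
Proof.
move=> hY Y'x y [n]; have cxx : component Y x x by exists 0.
suff H z : component Y x z -> Y' z -> walk (inside Y) n z y ->
    component Y' z y by apply: H.
elim: n z => [|n IH] z cz Y'z /=; first by move<-; exists 0.
move=> [w zw wy]; have Y'w := hY _ _ zw cz Y'z.
have [m wm] := IH w (component_rcons cz zw) Y'w wy.
by exists m.+1; exists w => //; split; [case: zw|].
Qed.

Lemma reach_edge Y A x y : G (y, x) -> Y y -> reach Y A x -> reach Y A y.
Proof.
move=> yx Yy [Yx [z Az [n xz]]]; split => //; exists z => //.
by exists n.+1; exists x.
Qed.

Lemma reachS Y Y' A : Y `<=` Y' -> reach Y A `<=` reach Y' A.
Proof.
move=> YY' x [/YY' Y'x [y Ay xy]]; split => //; exists y => //.
by apply: component_subset xy => // u v [_ [_ /YY']].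
Qed.

End Neighborhoods.

(** * Ranks, exposed vertices and their fringe *)

Section Layers.
Local Open Scope nat_scope.
Context {T : Type} {G : set (T * T)} (symG : forall x y, G (x, y) -> G (y, x)).
Context {X : nat -> set T} {P : nat}.

Definition core n := ~` tail_union X n.

(* The set written S_n(x) above; [touch_count n x t] is the cardinal of its
   intersection with [0, t]. *)
Definition touches n x := [set t | n <= t /\ reach G (core n) (nbr G (X t)) x].

Definition touch_count n x t := \sum_(i < t.+1) (`[< touches n x i >] : nat).

(* Maximizing over [m >= n], and not just taking [m = n], makes the rank
   nonincreasing in [n], hence the sets [deep n 0] increasing. *)
Definition rank_ge n x t i := exists2 m, n <= m & i <= touch_count m x t.

(* [deep n 0] is W_n; distances are at least 5 f_t - 1 - r in [deep n r], where
   the rank f_t is at least i + 1. *)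
Definition deep n r := [set x | core n x /\ forall t i, n <= t ->
  rank_ge n x t i.+1 -> ~ vicinity G (tail_union X t) (5 * i + 3 - r) x].

Definition exposed := \bigcup_(n in [set n | 0 < n])
  (nbr G (deep n 0) `\` deep n 0).

Definition fringe := exposed `|` nbr G exposed.

Hypothesis finite_core : forall n, 0 < n -> finite_components G (core n).
Hypothesis core_cover : forall x, exists2 n, 0 < n & core n x.
(** The form in which orthogonality is used; the inequality [5 * P <= Q] supplies the range of
    [l]. *)
Hypothesis orthogonal : forall n x t l, 0 < n -> core n x -> n <= t ->
  l <= 5 * P -> vicinity G (tail_union X t) l x ->
  exists2 u, t <= u & touches n x u.
Hypothesis touch_count_le : forall n x t, 0 < n -> touch_count n x t <= P.

Lemma coreS n m : n <= m -> core n `<=` core m.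
Proof. by move=> nm x nx [k /= mk kx]; apply: nx; exists k => //=; apply: leq_trans mk. Qed.

Lemma touchesS n m x : n <= m -> touches n x `&` [set t | m <= t] `<=` touches m x.
Proof.
by move=> nm t [[nt rt] /= mt]; split => //; apply: reachS rt; apply: coreS.
Qed.

Lemma touch_countS n x t :
  touch_count n x t.+1 = touch_count n x t + `[< touches n x t.+1 >].
Proof. by rewrite /touch_count big_ord_recr. Qed.

Lemma touch_countW n x t u : t <= u -> touch_count n x t <= touch_count n x u.
Proof.
move=> /subnKC <-; elim: (u - t) => [|k IH]; first by rewrite addn0.
by rewrite addnS touch_countS; apply: leq_trans IH _; apply: leq_addr.
Qed.

Lemma touch_count_gt n x t u : t < u -> touches n x u ->
  touch_count n x t < touch_count n x u.
Proof.
case: u => // u; rewrite ltnS => tu xu; rewrite touch_countS asboolT//= addn1.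
by rewrite ltnS; apply: touch_countW.
Qed.

Lemma touch_count_gt0 n x t : 0 < touch_count n x t ->
  exists2 s, s <= t & touches n x s.
Proof.
rewrite lt0n; apply: contraPP => h; apply/negP; rewrite negbK.
rewrite /touch_count big1// => i _; case: asboolP => // xi; case: h.
by exists i => //; rewrite -ltnS.
Qed.

Lemma touch_count_start n x t : 0 < touch_count n x t -> n <= t.
Proof. by move=> /touch_count_gt0[s st [ns _]]; apply: leq_trans st. Qed.

(** From [m] on, a wall touched at level [n] is touched at level [m], so between [t] and [u] the
    count at [m] grows at least as much. The additive form avoids truncated subtraction. *)
Lemma touch_count_diff n m x t u : n <= m -> m <= t -> t <= u ->
  touch_count n x u + touch_count m x t <= touch_count m x u + touch_count n x t.
Proof.
move=> nm mt /subnKC <-; elim: (u - t) => [|k IH]; first by rewrite addn0 addnC.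
rewrite addnS !touch_countS.
have : `[< touches n x (t + k).+1 >] <= `[< touches m x (t + k).+1 >].
  case: asboolP => //= h; rewrite asboolT//; apply: (touchesS nm); split => //=.
  lia.
lia.
Qed.

Lemma touches_edge n x y : G (x, y) -> core n x -> core n y ->
  touches n x = touches n y.
Proof.
move=> xy nx ny; rewrite eqEsubset; split => t [nt rt]; split => //.
  by apply: reach_edge rt => //; apply: symG.
by apply: reach_edge rt.
Qed.

Lemma rank_ge_edge n x y t i : G (x, y) -> core n x -> core n y ->
  rank_ge n x t i -> rank_ge n y t i.
Proof.
move=> xy nx ny [m nm mi]; exists m => //; move: mi; rewrite /touch_count.
by rewrite (touches_edge xy (coreS nm nx) (coreS nm ny)).
Qed.

Lemma rank_geW n m x t u i j : n <= m -> t <= u -> j <= i ->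
  rank_ge m x t i -> rank_ge n x u j.
Proof.
move=> nm tu ji [k mk ki]; exists k; first exact: leq_trans mk.
exact: leq_trans ji (leq_trans ki (touch_countW _ _ tu)).
Qed.

Lemma rank_ge_le n x t i : 0 < n -> rank_ge n x t i -> i <= P.
Proof.
move=> n0 [m nm mi]; apply: leq_trans mi (touch_count_le _ _ _).
exact: leq_trans nm.
Qed.

Lemma deepW n r r' x : r <= r' -> deep n r x -> deep n r' x.
Proof.
move=> rr' [nx dx]; split => // t i nt ri vi; apply: (dx t i nt ri).
by apply: vicinityW vi; lia.
Qed.

(** Distances change by at most 1 along an edge. Moreover [y] stays in the core: otherwise [x] would
    touch a wall, of rank at least 1, at distance 1, while its distance must exceed [3 - r]. *)
Lemma deep_step n r x y : r <= 2 -> deep n r x -> G (x, y) -> deep n r.+1 y.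
Proof.
move=> r2 [nx dx] xy; have ny : core n y.
  move=> [u /= nu uy]; have xu : touches n x u.
    split => //; split => //; exists x; first by exists y.
    by exists 0.
  apply: (dx u 0 nu).
    exists n => //; rewrite /touch_count (bigD1 ord_max)//= asboolT//.
  apply: (@vicinityW _ _ _ 1); first by lia.
  by right; exists y => //; exists u => /=.
split => // t i nt ri vi; apply: (dx t i nt).
  by apply: rank_ge_edge ri => //; apply: symG.
rewrite (_ : 5 * i + 3 - r = (5 * i + 3 - r.+1).+1); last by lia.
by right; exists y.
Qed.

(** Beyond [t0] the component of [x] in [core k] touches no wall. By orthogonality [x] is then far
    from all later tails, so any level beyond [t0] is deep enough. *)
Lemma deep_cover x : exists2 n, 0 < n & deep n 0 x.
Proof.
have [k k0 kx] := core_cover x.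
have bound j : `[< exists t, j <= touch_count k x t >] -> j <= P.
  by move=> /asboolP[t jt]; apply: leq_trans jt (touch_count_le _ _ _).
have [|j /asboolP[t0 jt0] jmax] := ex_maxnP _ bound.
  by exists 0; apply/asboolP; exists 0.
exists (maxn k t0.+1); first by rewrite leq_max k0.
split; first by apply: coreS kx; apply: leq_maxl.
move=> t i; rewrite geq_max => /andP[kt t0t] ri vi.
have iP : i.+1 <= P by apply: rank_ge_le ri; rewrite leq_max k0.
have [|u tu ku] := orthogonal k0 kx kt _ vi; first by lia.
have : j.+1 <= j.
  apply: jmax; apply/asboolP; exists u; apply: leq_ltn_trans jt0 _.
  by apply: touch_count_gt => //; apply: leq_trans tu.
by rewrite ltnn.
Qed.

Lemma finite_components_core_subset (Y : set T) :
  (forall x, Y x -> exists2 n, 0 < n & component G Y x `<=` component G (core n) x /\ core n x) ->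
  finite_components G Y.
Proof.
move=> hY x /hY[n n0 [cx nx]]; apply: sub_finite_set cx _.
exact: finite_core.
Qed.

(** An edge leaving [deep n 0] has an exposed end, so a component off [exposed] stays inside
    [deep n 0]. *)
Lemma finite_components_unexposed : finite_components G (~` exposed).
Proof.
apply: finite_components_core_subset => x _; have [n n0 dx] := deep_cover x.
exists n => //; split; last by case: dx.
suff : component G (~` exposed) x `<=` component G (deep n 0) x.
  move=> h y /h; apply: component_subset; last by case: dx.
  by move=> u v [_ [_ []]].
apply: component_subset => // u v [uv [_ nv]] _ du; apply: contrapT => ndv.
by apply: nv; exists n => //; split => //; exists u => //; apply: symG.
Qed.

(** The window of [x] at level [n]: its distance to some tail, of rank at least [i + 1], is between
    [5 * i + 2] and [5 * i + 4]. *)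
Definition fringe_at n x := [/\ 0 < n, deep n 2 x & exists t i,
  [/\ n <= t, rank_ge n x t i.+1 & vicinity G (tail_union X t) (5 * i + 4) x]].

(** An exposed vertex is adjacent to some [deep n 0] without lying in it, so it is within
    [5 * i + 3] of a tail; moving to a neighbor loosens both bounds by one. *)
Lemma fringeP x : fringe x -> exists n, fringe_at n x.
Proof.
have ex y : exposed y -> exists n, [/\ 0 < n, deep n 1 y & exists t i,
    [/\ n <= t, rank_ge n y t i.+1 & vicinity G (tail_union X t) (5 * i + 3) y]].
  move=> [n /= n0 [[z dz yz] ndy]]; have dy : deep n 1 y.
    by apply: deep_step dz _ => //; apply: symG.
  exists n; split => //; apply: contrapT => h; apply: ndy.
  split; [by case: dy|move=> t i nt ri vi; apply: h].
  by exists t, i; split => //; rewrite subn0 in vi.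
move=> [/ex[n [n0 dx [t [i [nt ri vi]]]]]|[y /ex[n [n0 dy [t [i [nt ri vi]]]]] xy]].
  exists n; split => //; first exact: deepW dx.
  by exists t, i; split => //; apply: vicinityW vi; lia.
have dx : deep n 2 x by apply: deep_step dy _ => //; apply: symG.
exists n; split => //; exists t, i; split => //.
  by apply: rank_ge_edge ri; [apply: symG|case: dy|case: dx].
by rewrite (_ : 5 * i + 4 = (5 * i + 3).+1); [right; exists y|lia].
Qed.

(** The invariant that will be constant on the components of [fringe]. *)
Definition top_wall n x i t := [/\ rank_ge n x t i,
  forall u j, rank_ge n x u j -> j <= i & forall u, rank_ge n x u i -> t <= u].

Lemma top_wall_exists n x t i : 0 < n -> rank_ge n x t i ->
  exists j u, top_wall n x j u /\ i <= j.
Proof.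
move=> n0 ri.
have bound j : `[< exists u, rank_ge n x u j >] -> j <= P.
  by move=> /asboolP[u]; apply: rank_ge_le.
have [|j /asboolP[u0 ju0] jmax] := ex_maxnP _ bound.
  by exists i; apply/asboolP; exists t.
have [|u /asboolP ru umin] := @ex_minnP (fun u => `[< rank_ge n x u j >]).
  by exists u0; apply/asboolP.
exists j, u; split; last by apply: jmax; apply/asboolP; exists t.
split => // [v k rv|v rv]; first by apply: jmax; apply/asboolP; exists v.
by apply: umin; apply/asboolP.
Qed.

Lemma top_wall_unique n x i t j u : top_wall n x i t -> top_wall n x j u ->
  i = j /\ t = u.
Proof.
move=> [ri mi ti] [rj mj uj]; have ij : i = j.
  by apply/eqP; rewrite eqn_leq (mj _ _ ri) (mi _ _ rj).
by subst j; split => //; apply/eqP; rewrite eqn_leq ti// uj.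
Qed.

Lemma top_wall_edge n x y i t : G (x, y) -> core n x -> core n y ->
  top_wall n x i t -> top_wall n y i t.
Proof.
move=> xy nx ny [ri mi ti]; have yx := symG xy.
split; first exact: rank_ge_edge ri.
- by move=> u j /(rank_ge_edge yx ny nx); apply: mi.
- by move=> u /(rank_ge_edge yx ny nx); apply: ti.
Qed.

(** The window of [x] at level [m] forces the ranks at [n] and [m] to agree from the wall [t] on,
    and orthogonality excludes a maximum first attained before [t]. *)
Lemma top_wall_up n m x t i j u : 0 < n -> n <= m -> m <= t -> deep n 3 x ->
  rank_ge m x t i.+1 -> vicinity G (tail_union X t) (5 * i + 4) x ->
  top_wall n x j u -> top_wall m x j u.
Proof.
move=> n0 nm mt [nx dx] ri vi [rj mj uj].
(* A rank [i + 2] would keep [x] farther than [5 * i + 5] from the tail, against the bound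
   [5 * i + 4]. *)
have rank_t k : rank_ge n x t k -> k <= i.+1.
  move=> rk; rewrite leqNgt; apply/negP => ik.
  apply: (dx t i.+1 (leq_trans nm mt)); first exact: rank_geW rk.
  by apply: vicinityW vi; lia.
(* If the count is attained at a level [a < m], a level [b >= m] with count at least [i + 1] at [t]
   starts no lower than [a] and gains no less beyond [t]. *)
have rank_up v k : t <= v -> rank_ge n x v k -> rank_ge m x v k.
  move=> tv [a na ka]; have [ma|am] := leqP m a; first by exists a.
  have [b mb ib] := ri; have bt := touch_count_start (leq_trans (ltn0Sn i) ib).
  exists b => //; have := touch_count_diff x (ltnW (leq_trans am mb)) bt tv.
  have := rank_t (touch_count a x t) (ex_intro2 _ _ a na (leqnn _)).
  lia.
have [tu|ut] := leqP t u.
  split; first exact: rank_up.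
  - by move=> v k rk; apply: (mj v); apply: rank_geW rk.
  - by move=> v rk; apply: uj; apply: rank_geW rk.
(* Otherwise, by orthogonality, a component attaining the maximal rank [j]
   already at [u] touches a further wall beyond [t]. *)
have ji : j <= i.+1 by apply: rank_t; apply: rank_geW rj => //; apply: ltnW.
have jE : j = i.+1.
  by apply/eqP; rewrite eqn_leq ji; apply: (mj t); apply: rank_geW ri.
have [a na ja] := rj; have au : a <= u.
  by apply: (@touch_count_start _ x); apply: leq_trans ja; rewrite jE.
have iP : i.+1 <= P by apply: rank_ge_le ri; apply: leq_trans nm.
have [|||||v tv av] := @orthogonal a x t (5 * i + 4).
- exact: leq_trans na.
- exact: coreS nx.
- by apply: ltnW; apply: leq_trans ut.
- lia.
- exact: vi.
have : j.+1 <= j.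
  apply: (mj v); exists a => //; apply: leq_ltn_trans ja _.
  by apply: touch_count_gt => //; apply: leq_trans tv.
by rewrite ltnn.
Qed.

(** Crossing the edge leads from [deep n 2] to [deep n 3], where [top_wall_up] applies from the
    smaller level to the larger. If [y] has the smaller level, its top wall is carried up at [x] and
    identified by uniqueness. *)
Lemma fringe_edge x y i t : G (x, y) -> fringe y ->
  (exists2 n, fringe_at n x & top_wall n x i t) ->
  exists2 n, fringe_at n y & top_wall n y i t.
Proof.
move=> xy /fringeP[m fy] [n fx tx]; exists m => //.
have [n0 dx [u [j [nu rj vj]]]] := fx; have [m0 dy [v [k [mv rk vk]]]] := fy.
have [nm|/ltnW mn] := leqP n m.
  have dy3 := deep_step (leqnn 2) dx xy.
  apply: (top_wall_up n0 nm mv dy3 rk vk); apply: top_wall_edge tx => //.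
    by case: dx.
  by case: dy3.
have dx3 := deep_step (leqnn 2) dy (symG xy).
have [i' [t' [tx' _]]] := top_wall_exists m0 (rank_geW mn (leqnn u) (leqnn _) rj).
have tx'' := top_wall_up m0 mn nu dx3 rj vj tx'.
have [-> ->] := top_wall_unique tx tx''.
by apply: top_wall_edge tx' => //; [case: dx3|case: dy].
Qed.

(** The pair [i], [t] is constant on a component, and a positive rank at [t] forces every level
    involved to be at most [t]; so the component lies in [core t]. *)
Lemma finite_components_fringe : finite_components G fringe.
Proof.
apply: finite_components_core_subset => x fx.
have [n fnx] := fringeP fx; have [n0 _ [u [j [nu rj _]]]] := fnx.
have [i [t [tx ji]]] := top_wall_exists n0 rj.
have in_core y : (exists2 n, fringe_at n y & top_wall n y i t) ->
    0 < t /\ core t y.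
  move=> [m [m0 [my _] _] [[a ma ia] _ _]].
  have mt : m <= t.
    apply: leq_trans ma (@touch_count_start _ y _ _).
    by apply: leq_trans ia; apply: leq_trans ji.
  by split; [exact: leq_trans mt|exact: coreS my].
have [t0 tcx] := in_core x (ex_intro2 _ _ n fnx tx).
exists t => //; split => //.
pose Z := [set y | exists2 n, fringe_at n y & top_wall n y i t].
suff : component G fringe x `<=` component G Z x.
  move=> h y /h; apply: component_subset => // a b [_ [_ /in_core[]]] //.
apply: component_subset; last by exists n.
by move=> a b [ab [_ fb]] _; apply: fringe_edge.
Qed.

End Layers.

Arguments core {T} X n _.
Arguments touches {T} G X n x _.
Arguments touch_count {T} G X n x t.
Arguments rank_ge {T} G X n x t i.
Arguments deep {T} G X n r _.
Arguments exposed {T} G X _.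
Arguments fringe {T} G X _.

(** * From the decomposition to the hypotheses on layers *)

Section DecompositionLayers.
Context {R : realType} {T : Type} {G : set (T * T)}.
Context {X : nat -> set T} {P : nat} {Q : R}.

Lemma component_sub (Y : set T) x : Y x -> component G Y x `<=` Y.
Proof.
move=> Yx y [n xy]; apply: (walk_invariant Yx _ xy).
by move=> u v [_ []].
Qed.

Lemma orthogonal_touches : orthogonality_constant G X Q -> 5 * P%:R <= Q ->
  forall n x t l, (0 < n)%N -> core X n x -> (n <= t)%N ->
  (l <= 5 * P)%N -> vicinity G (tail_union X t) l x ->
  exists2 u, (t <= u)%N & touches G X n x u.
Proof.
move=> hQ PQ n x t l n0 nx nt lP vx; have [k kl [y ty xy]] := vicinity_walk vx.
have cx : induced_component G (~` tail_union X n) (component G (core X n) x).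
  by exists x.
have : graph_set_dist R G (component G (core X n) x) (tail_union X t) = 1%E.
  apply: (hQ n) => //; apply: ge_ereal_inf; exists (graph_dist R G x y).
    by exists x; [exists 0%N|exists y].
  apply: ge_ereal_inf; exists k%:R%:E; first by exists k.
  rewrite lee_fin; apply: le_trans PQ; rewrite -natrM ler_nat.
  exact: leq_trans lP.
(* An infimum below 2 is witnessed by a walk of length 0 or 1, and length 0 would put a point of the
   core into the tail. *)
move=> d1; have : (graph_set_dist R G (component G (core X n) x)
    (tail_union X t) < 2%:E)%E by rewrite d1 lte_fin; lra.
move=> /ereal_inf_lt[_ [a ca [b tb <-]]] /ereal_inf_lt[_ [m ab <-]].
rewrite lte_fin ltr_nat; have na : core X n a by apply: component_sub ca.
case: m ab => [|[|//]] /= ab _.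
  by case: na; rewrite ab; case: tb => u /= tu ub; exists u => //=; apply: leq_trans tu.
have {ab}[c ac cb] := ab; rewrite cb in ac; case: tb => u /= tu ub.
exists u => //; split; first exact: leq_trans tu.
by split => //; exists a => //; exists b.
Qed.

Lemma card_le_uniq (s : seq nat) : uniq s -> [set` s] #<= `I_P ->
  (size s <= P)%N.
Proof.
move=> us /pcard_leP[f]; rewrite -(size_map f s) -[leqRHS](size_iota 0).
apply: uniq_leq_size.
  by rewrite map_inj_in_uniq// => x y xs ys; apply: (@inj _ _ _ f); rewrite inE.
move=> _ /mapP[x xs ->]; rewrite mem_iota add0n /=.
exact: (@funS _ _ _ _ f x xs).
Qed.

(** A touched wall is at distance exactly 1, since a walk of length 0 would leave the core; off the
    core nothing is touched. *)
Lemma touch_count_bounded : geometry_bounded_by R G X P ->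
  forall n x t, (0 < n)%N -> (touch_count G X n x t <= P)%N.
Proof.
move=> hP n x t n0; rewrite /touch_count.
have [nx|nnx] := pselect (core X n x); last first.
  by rewrite big1// => i _; case: asboolP => // -[_ [/nnx]].
rewrite -(big_mkord xpredT (fun i => nat_of_bool `[< touches G X n x i >])).
rewrite -big_mkcond /= sum1_count -size_filter; apply: card_le_uniq.
  by rewrite filter_uniq// iota_uniq.
have cx : induced_component G (~` tail_union X n) (component G (core X n) x).
  by exists x.
apply: card_le_trans (hP n _ n0 cx); apply: subset_card_le => i.
rewrite /mkset mem_filter => /andP[/asboolP[ni [_ [y [z iz yz] xy]]] _]; split => //.
apply/eqP; rewrite eq_le; apply/andP; split.
  apply: ge_ereal_inf; exists (graph_dist R G y z).
    by exists y => //; exists z.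
  by apply: ge_ereal_inf; exists 1%E => //; exists 1%N => //; exists z.
apply/ereal_infP => _ [a ca [b ib <-]]; apply/ereal_infP => _ [m ab <-].
rewrite lee_fin ler1n lt0n; apply/eqP => m0; rewrite m0 /= in ab.
by have [] := component_sub nx ca; rewrite ab; exists i.
Qed.

End DecompositionLayers.

(** * Borel colorings *)

Section BorelGraph.
Local Open Scope nat_scope.
Context {d : measure_display} {T : measurableType d} {G : set (T * T)}.
Hypothesis symG : forall x y, G (x, y) -> G (y, x).
Hypothesis measurable_nbr : forall A, measurable A -> measurable (nbr G A).

Lemma measurable_vicinity (A : set T) l : measurable A ->
  measurable (vicinity G A l).
Proof.
by move=> mA; elim: l => //= l IH; apply: measurableU => //; apply: measurable_nbr.
Qed.

Lemma measurable_reach (Y A : set T) : measurable Y -> measurable A ->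
  measurable (reach G Y A).
Proof.
move=> mY mA.
pose Z n := [set x | exists2 y, (A `&` Y) y & walk (inside G Y) n x y].
rewrite (_ : reach G Y A = Y `&` [set x | exists n, Z n x]).
  apply: measurableI => //; apply: measurable_ex; elim => [|n IH].
    rewrite (_ : Z 0 = A `&` Y); first exact: measurableI.
    by rewrite eqEsubset; split => [x [y Ay /= ->]//|x Ax]; exists x.
  rewrite (_ : Z n.+1 = Y `&` nbr G (Y `&` Z n)).
    by apply: measurableI => //; apply: measurable_nbr; apply: measurableI.
  rewrite eqEsubset; split => x.
    move=> [y Ay [z [xz [/= Yx Yz]] zy]]; split => //.
    by exists z => //; split => //; exists y.
  by move=> [Yx [z [Yz [y Ay zy]] xz]]; exists y => //; exists z.
rewrite eqEsubset; split => x.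
  move=> [Yx [y Ay xy]]; split => //; have [n xny] := xy.
  by exists n; exists y => //; split => //; apply: component_sub xy.
by move=> [Yx [n [y [Ay _] xy]]]; split => //; exists y => //; exists n.
Qed.

(** * Borelness of the layers *)

Section LayersMeasurable.
Context {X : nat -> set T}.
Hypothesis mX : forall n, 0 < n -> measurable (X n).

Lemma measurable_tail_union n : 0 < n -> measurable (tail_union X n).
Proof.
by move=> n0; apply: bigcup_measurable => k nk; apply: mX; apply: leq_trans nk.
Qed.

Lemma measurable_core n : 0 < n -> measurable (core X n).
Proof. by move=> n0; apply/measurableC/measurable_tail_union. Qed.

Lemma measurable_touches n t : 0 < n -> measurable [set x | touches G X n x t].
Proof.
move=> n0; apply: (measurable_and_prop (A := reach G (core X n) (nbr G (X t)))).
move=> nt; apply: measurable_reach; first exact: measurable_core.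
by apply: measurable_nbr; apply: mX; apply: leq_trans nt.
Qed.

Lemma measurable_touch_count n t i : 0 < n ->
  measurable [set x | i <= touch_count G X n x t].
Proof.
move=> n0; rewrite /touch_count; elim: t.+1 i => {t} [|t IH] i.
  under eq_set do rewrite big_ord0; exact: measurable_prop.
rewrite (_ : mkset _ = [set x | i <= \sum_(j < t) `[< touches G X n x j >]] `|`
  ([set x | i <= (\sum_(j < t) `[< touches G X n x j >]).+1] `&`
   [set x | touches G X n x t])).
  apply: measurableU => //; apply: measurableI; last exact: measurable_touches.
  case: i => [|i]; last exact: IH.
  by rewrite (_ : mkset _ = setT)// eqEsubset; split.
rewrite eqEsubset; split => x /=; rewrite big_ord_recr /=.
  case: asboolP => h; first by rewrite addn1; right.
  by rewrite addn0; left.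
move=> [h|[h xt]]; first exact: leq_trans h (leq_addr _ _).
by rewrite asboolT// addn1.
Qed.

Lemma measurable_rank_ge n t i : 0 < n ->
  measurable [set x | rank_ge G X n x t i].
Proof.
move=> n0; rewrite (_ : mkset _ = [set x | exists m, n <= m /\
    [set x | i <= touch_count G X m x t] x]).
  apply: measurable_ex => m; apply: measurable_and_prop => nm.
  by apply: measurable_touch_count; apply: leq_trans nm.
by rewrite eqEsubset; split => x [m]; [exists m|case=> ? ?; exists m].
Qed.

Lemma measurable_deep n r : 0 < n -> measurable (deep G X n r).
Proof.
move=> n0; apply: measurableI; first exact: measurable_core.
apply: measurable_all => t; apply: measurable_all => i.
pose V := vicinity G (tail_union X t) (5 * i + 3 - r).
apply: (measurable_imply (P := n <= t)
  (A := [set x | rank_ge G X n x t i.+1 -> ~ V x])) => nt.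
rewrite (_ : mkset _ = ~` [set x | rank_ge G X n x t i.+1] `|` ~` V).
  apply: measurableU; apply: measurableC; first exact: measurable_rank_ge.
  by apply: measurable_vicinity; apply: measurable_tail_union; apply: leq_trans nt.
rewrite eqEsubset; split => x /=; last by move=> [h /h|].
by have [r1 /(_ r1)|] := pselect (rank_ge G X n x t i.+1); [right|left].
Qed.

Lemma measurable_exposed : measurable (exposed G X).
Proof.
apply: bigcup_measurable => n n0; have mW := measurable_deep 0 n0.
by apply: measurableD => //; apply: measurable_nbr.
Qed.

Lemma measurable_fringe : measurable (fringe G X).
Proof.
have mE := measurable_exposed.
by apply: measurableU => //; apply: measurable_nbr.
Qed.

End LayersMeasurable.

(** * Borel colorings on sets with finite components *)

Section Coloring.
Context {D : nat -> set T} {chi : nat} {c : T -> 'I_chi}.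
Hypothesis mD : forall i, measurable (D i).
Hypothesis sepD : forall x y, x <> y -> exists i, D i x /\ ~ D i y.
Hypothesis cG : proper_coloring G c.

Definition trace_class (s : seq bool) :=
  [set x | forall i : 'I_(size s), if nth false s i then D i x else ~ D i x].

(** Step functions coded by finite lists: a countable supply of Borel colorings. *)
Fixpoint simple_coloring (w : seq (seq bool * 'I_chi)) x : 'I_chi :=
  if w is sc :: w' then
    if `[< trace_class sc.1 x >] then sc.2 else simple_coloring w' x
  else c point.

Lemma measurable_simple_coloring w a :
  measurable [set x | simple_coloring w x = a].
Proof.
elim: w => [|[s b] w IH] /=; first exact: measurable_prop.
have ms : measurable (trace_class s).
  by apply: measurable_all => i; case: nth => //; apply: measurableC.
rewrite (_ : mkset _ = (trace_class s `&` [set _ | b = a]) `|`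
    (~` trace_class s `&` [set x | simple_coloring w x = a])).
  by apply: measurableU; apply: measurableI => //; [apply: measurable_prop|apply: measurableC].
rewrite eqEsubset; split => x /=; case: asboolP => h.
- by left.
- by right.
- by case=> [[]|[]].
- by case=> [[]|[]].
Qed.

Lemma simple_coloring_extends (F : set T) : finite_set F ->
  exists w, forall x, F x -> simple_coloring w x = c x.
Proof.
move=> fF; have [n hn] := finite_trace_separation sepD fF.
have [ys Fys] := (finite_seqP _).1 fF.
exists [seq (mkseq (fun i => `[< D i y >]) n, c y) | y <- ys] => x Fx.
have xys : x \in ys by move: Fx; rewrite Fys.
have Fsub : {subset ys <= F} by move=> y yys; rewrite inE Fys.
elim: ys {Fys} xys Fsub => // y ys IH; rewrite inE => xys Fsub /=.
case: asboolP => [h|h].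
  congr c; apply: hn => //.
    by have := Fsub y; rewrite inE eqxx inE; apply.
  move=> i ni; have ni' : i < size (mkseq (fun i => `[< D i y >]) n).
    by rewrite size_mkseq.
  have := h (Ordinal ni'); rewrite /= nth_mkseq//.
  by case: asboolP => // Dy nDx; split.
apply: IH => [|z zys]; last by apply: Fsub; rewrite inE zys orbT.
case/orP: xys => // /eqP xy; case: h => i /=.
have ni : i < n by have := ltn_ord i; rewrite [X in _ < X]size_mkseq.
by rewrite nth_mkseq// xy; case: asboolP.
Qed.

(** Each component uses the first simple coloring that is proper on it, which exists by finiteness;
    [reach G Y (bad k)] consists of the components where coloring [k] fails. *)
Lemma measurable_coloring_finite_components (Y : set T) : measurable Y ->
  finite_components G Y -> exists c' : T -> 'I_chi,
    (forall a, measurable [set x | c' x = a]) /\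
    forall x y, Y x -> Y y -> G (x, y) -> c' x <> c' y.
Proof.
move=> mY fY.
pose wk k : seq (seq bool * 'I_chi) := odflt [::] (unpickle k).
pose level k a := [set x | simple_coloring (wk k) x = a] `&` Y.
pose bad k := [set x | exists a, level k a x /\ nbr G (level k a) x].
have mlevel k a : measurable (level k a).
  by apply: measurableI => //; apply: measurable_simple_coloring.
have mbad k : measurable (bad k).
  apply: measurable_ex => a; apply: measurableI; first exact: mlevel.
  exact/measurable_nbr/mlevel.
pose least k x := ~ reach G Y (bad k) x /\
  forall j : 'I_k, reach G Y (bad j) x.
have mleast k : measurable [set x | least k x].
  apply: measurableI; first exact/measurableC/measurable_reach.
  by apply: measurable_all => j; apply: measurable_reach.
have exgood x : exists k, ~ reach G Y (bad k) x.
  have [Yx|nYx] := pselect (Y x); last by exists 0 => -[].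
  have [w hw] := simple_coloring_extends (fY _ Yx).
  exists (pickle w) => -[_ [y [a [[ya Yy] [z [za Yz] yz]]] xy]].
  rewrite /wk pickleK /= in ya za.
  have xz : component G Y x z by apply: component_rcons xy _.
  by apply: (cG yz); rewrite -(hw _ xy) -(hw _ xz) ya za.
have /choice[k hk] : forall x, exists k, least k x.
  move=> x; have ex : exists k, `[< ~ reach G Y (bad k) x >].
    by have [k kx] := exgood x; exists k; apply/asboolP.
  case: (ex_minnP ex) => k /asboolP kx kmin; exists k; split => // j.
  apply: contrapT => jx; have := kmin j; rewrite leqNgt ltn_ord.
  by move=> /(_ (asboolT jx)).
have least_inj x j : least j x -> j = k x.
  move=> [jx jmin]; have [kx kmin] := hk x; have [jk|kj|//] := ltngtP j (k x).
    by case: jx; apply: (kmin (Ordinal jk)).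
  by case: kx; apply: (jmin (Ordinal kj)).
exists (fun x => simple_coloring (wk (k x)) x); split=> [a|x y Yx Yy xy e].
  rewrite (_ : mkset _ = [set x | exists j, least j x /\
      simple_coloring (wk j) x = a]).
    apply: measurable_ex => j.
    exact: (measurableI _ _ (mleast j) (measurable_simple_coloring (wk j) a)).
  rewrite eqEsubset; split => x /=; first by exists (k x).
  by move=> [j [/least_inj -> ]].
have reach_eq j : reach G Y (bad j) x = reach G Y (bad j) y.
  by apply/propext; split; apply: reach_edge => //; apply: symG.
have kxy : k y = k x.
  apply: least_inj; have [ky kmin] := hk y.
  by split=> [|j]; rewrite reach_eq//; apply: kmin.
have [kx _] := hk x; apply: kx; split => //; exists x; last by exists 0.
exists (simple_coloring (wk (k x)) x); split => //.
by exists y => //; split => //=; rewrite e kxy.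
Qed.

End Coloring.
End BorelGraph.

(** * Merging two colorings *)

Section TwoColorings.
Context {d : measure_display} {T : measurableType d} {G : set (T * T)}.
Hypothesis symG : forall x y, G (x, y) -> G (y, x).
Hypothesis measurable_nbr : forall A, measurable A -> measurable (nbr G A).

Lemma measurable_fun_nat (f : T -> nat) :
  (forall n, measurable [set x | f x = n]) -> measurable_fun setT f.
Proof.
move=> mf _ Y _; rewrite setTI.
rewrite (_ : _ @^-1` _ = [set x | exists n, Y n /\ [set x | f x = n] x]).
  by apply: measurable_ex => n; apply: measurable_and_prop.
by rewrite eqEsubset; split => x /=; [exists (f x)|move=> [n [+ ->]]].
Qed.

Lemma measurable_fun_asbool (A : set T) : measurable A ->
  measurable_fun setT (fun x => `[< A x >]).
Proof.
move=> mA; apply: (@measurable_fun_bool _ _ _ _ true); rewrite setTI.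
rewrite (_ : _ @^-1` _ = A)// eqEsubset; split => x /=; first by move/asboolP.
by move=> Ax; apply/asboolP.
Qed.

(* Off [U] use the colors [0, ..., chi - 1], on [U] the colors [0, chi, ...,
   2 chi - 2]. The color 0 is shared, so a vertex off [U] which has color 0 and
   is adjacent to a vertex of [U] of color 0 is recolored according to the
   coloring of [U], which gives it a color other than 0. *)
Lemma borel_colorable_union (U : set T) (chi : nat) (c0 c1 : T -> 'I_chi) :
  measurable U ->
  (forall a, measurable [set x | c0 x = a]) ->
  (forall a, measurable [set x | c1 x = a]) ->
  (forall x y, ~ U x -> ~ U y -> G (x, y) -> c0 x <> c0 y) ->
  (forall x y, (U `|` nbr G U) x -> (U `|` nbr G U) y -> G (x, y) ->
     c1 x <> c1 y) ->
  borel_colorable G `I_(2 * chi - 1).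
Proof.
move=> mU m0 m1 p0 p1.
have mnat (c : T -> 'I_chi) (h : nat -> nat) :
    (forall a, measurable [set x | c x = a]) ->
    measurable_fun setT (fun x => h (c x)).
  move=> mc; apply: measurable_fun_nat => n.
  rewrite (_ : mkset _ = [set x | exists a : 'I_chi, h a = n /\ [set x | c x = a] x]).
    by apply: measurable_ex => a; apply: measurable_and_prop.
  by rewrite eqEsubset; split => x /=; [exists (c x)|move=> [a [+ ->]]].
pose Z := U `&` [set x | c1 x = 0%N :> nat].
have mZ : measurable Z.
  apply: measurableI => //.
  by have := mnat c1 id m1 measurableT [set 0%N]; rewrite setTI; apply.
pose shift n := if n == 0%N then 0%N else (n + chi.-1)%N.
pose c x : nat := if `[< U x >] then shift (c1 x) else
  if c0 x != 0%N :> nat then c0 x : nat else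
  if `[< nbr G Z x >] then shift (c1 x) else 0%N.
exists c; split.
- apply: measurable_fun_ifT; first exact: measurable_fun_asbool.
    exact: mnat.
  apply: measurable_fun_ifT.
  + apply: (@measurable_fun_bool _ _ _ _ false); rewrite setTI.
    rewrite (_ : _ @^-1` _ = [set x | c0 x = 0%N :> nat]).
      by have := mnat c0 id m0 measurableT [set 0%N]; rewrite setTI; apply.
    by rewrite eqEsubset; split => x /=; [move/negbFE/eqP|move=> ->].
  + exact: (mnat c0 id).
  + apply: measurable_fun_ifT; last exact: measurable_cst.
      by apply: measurable_fun_asbool; apply: measurable_nbr.
    exact: mnat.
- move=> x; rewrite /c /shift /=; have := ltn_ord (c0 x); have := ltn_ord (c1 x).
  by do !case: ifP; lia.
(* Colors [1, ..., chi - 1] come only from [c0] off [U], and colors from [chi] on only from [c1] on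
   [U] and its neighbors; the two colorings interact only at color 0. *)
- have zeroP z : c z = 0%N -> (U z -> c1 z = 0%N :> nat) /\
      (~ U z -> c0 z = 0%N :> nat /\ ~ nbr G Z z).
    rewrite /c /shift; have := ltn_ord (c1 z); case: asboolP => Uz.
      by case: eqP => [//|c1z _ h]; exfalso; lia.
    case: eqP => //= c0z; case: asboolP => [[w [Uw c1w] zw]|//] l1.
    case: eqP => [c1z _|c1z h]; last by exfalso; lia.
    case: (p1 z w) => //; [by right; exists w|by left|].
    by apply: ord_inj; rewrite c1z.
  have smallP z : (0 < c z < chi)%N -> ~ U z /\ c z = c0 z.
    rewrite /c /shift; case: asboolP => Uz; first by case: eqP; lia.
    case: eqP => //= c0z; case: asboolP => // _; case: eqP; lia.
  have largeP z : (chi <= c z)%N ->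
      (U `|` nbr G U) z /\ c z = (c1 z + chi.-1)%N.
    have := ltn_ord (c0 z); rewrite /c /shift; case: asboolP => Uz.
      by case: eqP => [_|_ _ _]; [lia|split; [left|]].
    case: eqP => /=; last lia.
    move=> _; case: asboolP => [[w [Uw _] zw]|_]; last lia.
    by case: eqP => [_|_ _ _]; [lia|split; [right; exists w|]].
  move=> x y xy e; have [cx0|cx0] := posnP (c x).
    have [ux nx] := zeroP x cx0; have [uy ny] := zeroP y (etrans (esym e) cx0).
    have [Ux|nUx] := pselect (U x); have [Uy|nUy] := pselect (U y).
    + by case: (p1 x y); [left|left| |apply: ord_inj; rewrite ux// uy].
    + by have [_] := ny nUy; apply; exists x; [split; [|apply: ux]|apply: symG].
    + by have [_] := nx nUx; apply; exists y; [split; [|apply: uy]|].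
    + case: (p0 x y) => //; apply: ord_inj.
      by have [-> _] := nx nUx; have [-> _] := ny nUy.
  have [cx|cx] := ltnP (c x) chi.
    have [|nUx xE] := smallP x; first by rewrite cx0.
    have [|nUy yE] := smallP y; first by rewrite -e cx0.
    by case: (p0 x y) => //; apply: ord_inj; rewrite -xE -yE.
  have [Vx xE] := largeP x cx; have [|Vy yE] := largeP y; first by rewrite -e.
  by case: (p1 x y) => //; apply: ord_inj; lia.
Qed.

End TwoColorings.

(** * Neighborhoods of Borel sets are Borel *)

Section BorelNeighbors.
Local Open Scope nat_scope.
Context {d : measure_display} {T : measurableType d} {G : set (T * T)}.
Context {B : nat -> nat -> set T} (hB : polish_base B) (mG : measurable G).
Context {X : nat -> set T}.
Hypothesis mX : forall n, 0 < n -> measurable (X n).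
Hypothesis finite_core : forall n, 0 < n -> finite_components G (core X n).
Hypothesis core_cover : forall x, exists2 n, 0 < n & core X n x.

(** The ends of an edge lie in a common core, where the neighbors of a vertex belong to its finite
    component; so the projection theorem for finite sections applies. *)
Lemma measurable_nbr (A : set T) : measurable A -> measurable (nbr G A).
Proof.
move=> mA; pose H n := G `&` (core X n.+1 `*` (A `&` core X n.+1)).
have mC n : measurable (core X n.+1) by apply: measurable_core.
rewrite (_ : nbr G A = [set x | exists n y, H n (x, y)]).
  apply: measurable_ex => n; apply: (measurable_finite_projection hB).
    by apply: measurableI => //; apply: measurableX => //; apply: measurableI.
  move=> x; have [nx|nnx] := pselect (core X n.+1 x).
    apply: sub_finite_set (finite_core (ltn0Sn n) nx) => y [xy [_ [_ ny]]].
    by exists 1; exists y.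
  rewrite (_ : mkset _ = set0); first exact: finite_set0.
  by rewrite -subset0 => y [_ []].
rewrite eqEsubset; split => x; last by move=> [n [y [xy [_ [Ay _]]]]]; exists y.
move=> [y Ay xy]; have [[//|n] _ nx] := core_cover x.
have [[//|m] _ my] := core_cover y; exists (maxn n m), y; split => //.
by do 2 ?split => //; [apply: coreS nx|apply: coreS my]; rewrite ltnS leq_max leqnn ?orbT.
Qed.

End BorelNeighbors.

(** * From a finite Borel coloring to the Borel chromatic number *)

Lemma borel_chromatic_number_exists (d : measure_display)
    (T : measurableType d) (G : set (T * T)) (n : nat) :
  borel_colorable G `I_n ->
  exists2 K : set nat, is_borel_chromatic_number G K & K #<= `I_n.
Proof.
move=> cn; have ex : exists m, `[< borel_colorable G `I_m >].
  by exists n; apply/asboolP.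
case: (ex_minnP ex) => m /asboolP cm mmin; exists `I_m.
  split => //; first by left; exists m.
  move=> _ [[k ->]|->] ck; last exact: card_leT.
  by rewrite card_le_II; apply: mmin; apply/asboolP.
by rewrite card_le_II; apply: mmin; apply/asboolP.
Qed.

Theorem corollary4p9 (R : realType) (d : measure_display)
    (T : measurableType d) (hT : standard_borel R T)
    (G : set (T * T)) (hG : borel_graph G)
    (chi : nat) (hchi : is_chromatic_number G chi)
    (X : nat -> set T) (P : nat) (Q : R)
    (hX : bounded_geometry_decomposition R G X)
    (hP : polygonal_bound R G X P)
    (hQ : orthogonality_constant G X Q)
    (hPQ : 5 * P%:R <= Q) :
  exists2 K : set nat, is_borel_chromatic_number G K &
    K #<= `I_(2 * chi - 1).
Proof.
have [[_ symG] mG] := hG; have [[mX finX capX _] _] := hX.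
have [geomP _] := hP; have [[c cG] _] := hchi.
have [B hB] := standard_borel_polish_base hT.
have [D [mD sepD]] := separating_sequence hB.
have fin n : (0 < n)%N -> finite_components G (core X n).
  by move=> n0 x nx; apply: (finX n) => //; exists x.
have cover x : exists2 n, (0 < n)%N & core X n x.
  apply: contrapT => h; suff : (\bigcap_(k >= 1) tail_union X k) x by rewrite capX.
  by move=> k /= k1; apply: contrapT => kx; apply: h; exists k.
have mnbr := measurable_nbr hB mG mX fin cover.
have orth := orthogonal_touches hQ hPQ.
have count := touch_count_bounded geomP.
have mU := measurable_exposed mnbr mX.
have mV := measurable_fringe mnbr mX.
have [c0 [m0 p0]] := measurable_coloring_finite_components symG mnbr mD sepD cG
  (measurableC mU) (finite_components_unexposed symG fin cover orth count).
(* [fringe] is [exposed] together with its neighbors, exactly where the merging needs the second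
   coloring to be proper. *)
have [c1 [m1 p1]] := measurable_coloring_finite_components symG mnbr mD sepD cG
  mV (finite_components_fringe symG fin orth count).
apply: borel_chromatic_number_exists.
exact: (borel_colorable_union symG mnbr mU m0 m1 p0 p1).
Qed.
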